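(* Let $(A_k)_{k\ge1}$ be a sequence of matrices taking values in a finite set $\mathcal{A}$ of matrices in $SL(2,\mathbb{Z})$ with (strictly) positive coefficients. Let $g$ be a real trigonometric polynomial on $\mathbb{T}^2$ with zero mean and let $S_n(t)=\sum_{k=1}^n g(\tau_k\cdots\tau_1 t)$. If there are a constant $C_1>0$ and a rank $n_0\geq 1$ such that $\|S_n\|_2\ge C_1 n^{1/2}$ for all $n\ge n_0$, then there is a constant $C$ such that $$d\Big(\frac{S_n}{\|S_n\|_2},Y_1\Big)\le C\,n^{-1/32},\qquad\forall n\ge n_0.$$
   Context: $\mathbb{T}^2=\mathbb{R}^2/\mathbb{Z}^2$ is equipped with Lebesgue measure $\lambda$; $\tau_k$ is the automorphism $x\mapsto A_k^t x\bmod 1$ of $\mathbb{T}^2$; $\|\cdot\|_2$ is the norm of $L^2(\mathbb{T}^2,\lambda)$. The sums $S_n$ are regarded as random variables on $(\mathbb{T}^2,\lambda)$. $Y_1$ is a random variable with law $\mathcal{N}(0,1)$. For real random variables $X,Y$, $d(X,Y)=\sup_{x\in\mathbb{R}}|\mathbb{P}(X\le x)-\mathbb{P}(Y\le x)|$ (a quantity depending only on the laws of $X$ and $Y$). *)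

(* Defs.v *)
From HB Require Import structures.
From mathcomp Require Import all_boot all_order all_algebra.
From mathcomp Require Import all_classical all_reals all_analysis.
From mathcomp Require Import measurable_realfun.
Set Implicit Arguments.
Unset Strict Implicit.
Unset Printing Implicit Defensive.
Import Order.TTheory GRing.Theory Num.Theory.
Import numFieldNormedType.Exports.
Local Open Scope classical_set_scope.
Local Open Scope ring_scope.
Local Open Scope quotient_scope.

Lemma measurable_fun_sumr d (T : measurableType d) (R : realType) (I : Type)
    (s : seq I) (h : I -> T -> R) :
  (forall i, measurable_fun [set: T] (h i)) ->
  measurable_fun [set: T] (fun x => \sum_(i <- s) h i x).
Proof.
move=> mh; elim: s => [|i s IH].
  by under eq_fun do rewrite big_nil; exact: measurable_cst.
by under eq_fun do rewrite big_cons; exact: measurable_funD.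
Qed.

Section torus_def.
Variable R : realType.

Definition congZ2 (x y : R * R) : bool :=
  (x.1 - y.1 \is a Num.int) && (x.2 - y.2 \is a Num.int).

(* The structure on R that carries lebesgue_measure and uniform_prob. *)
Local Notation plane := (measurableTypeR R * measurableTypeR R)%type.

Lemma congZ2_refl : reflexive congZ2.
Proof. by move=> x; rewrite /congZ2 !subrr !rpred0. Qed.

Lemma congZ2_sym : symmetric congZ2.
Proof. by move=> x y; rewrite /congZ2 -rpredN opprB -[X in _ && X]rpredN opprB. Qed.

Lemma congZ2_trans : transitive congZ2.
Proof.
move=> y x z /andP[xy1 xy2] /andP[yz1 yz2]; apply/andP; split.
  by rewrite -(subrKA y.1) rpredD.
by rewrite -(subrKA y.2) rpredD.
Qed.

Canonical congZ2_equiv :=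
  EquivRel congZ2 congZ2_refl congZ2_sym congZ2_trans.

Definition torus : Type := {eq_quot congZ2}.
HB.instance Definition _ := Choice.on torus.
HB.instance Definition _ := EqQuotient.on torus.
HB.instance Definition _ := isPointed.Build torus (\pi_torus (0, 0)).

Definition to_torus : plane -> torus := \pi_torus.

(* The quotient sigma-algebra; it is the Borel sigma-algebra of the torus,
   because to_torus is a continuous open countable-to-one map. *)
Definition torus_measurable : set (set torus) :=
  [set B | measurable (to_torus @^-1` B)].

Let torus_measurable0 : torus_measurable set0.
Proof. by rewrite /torus_measurable /= preimage_set0. Qed.

Let torus_measurableC B : torus_measurable B -> torus_measurable (~` B).
Proof. by rewrite /torus_measurable /= preimage_setC; exact: measurableC. Qed.

Let torus_measurable_bigcup (F : (set torus)^nat) :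
  (forall i, torus_measurable (F i)) -> torus_measurable (\bigcup_i F i).
Proof.
by move=> mF; rewrite /torus_measurable /= preimage_bigcup;
  apply: bigcupT_measurable.
Qed.

Definition torus_display : measure_display. Proof. by []. Qed.

HB.instance Definition _ := @isMeasurable.Build torus_display torus
  torus_measurable torus_measurable0 torus_measurableC torus_measurable_bigcup.

Lemma measurable_to_torus :
  measurable_fun [set: plane] to_torus.
Proof. by move=> _ B mB; rewrite setTI. Qed.

HB.instance Definition _ :=
  isMeasurableFun.Build _ _ _ _ to_torus measurable_to_torus.

Lemma measurable_fun_torus d (T : measurableType d) (f : torus -> T) :
  measurable_fun [set: plane] (f \o to_torus) ->
  measurable_fun [set: torus] f.
Proof.
by move=> mf _ B mB; rewrite setTI; have := mf measurableT _ mB; rewrite setTI.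
Qed.

Lemma to_torusP (x y : R * R) : reflect (to_torus x = to_torus y) (congZ2 x y).
Proof.
by apply: (iffP idP) => [xy|/eqquotP//]; apply/eqquotP.
Qed.

Lemma congZ2_repr (x : R * R) : congZ2 (repr (to_torus x)) x.
Proof. by apply/to_torusP; rewrite /to_torus reprK. Qed.

(* uniform_prob on [0, 1] is Lebesgue measure on [0, 1], so this is the image
   in the torus of Lebesgue measure on the unit square. *)
Definition lebesgue_torus : probability torus R :=
  distribution (uniform_prob (@ltr01 R) \x uniform_prob (@ltr01 R))%E
    to_torus.

Definition int_lin (M : 'M[int]_2) (x : R * R) : R * R :=
  ((M 0 0)%:~R * x.1 + (M 0 1)%:~R * x.2,
   (M 1 0)%:~R * x.1 + (M 1 1)%:~R * x.2).

(* x |-> A^t x mod 1; toral_autE says that it does not depend on the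
   representative. *)
Definition toral_aut (A : 'M[int]_2) (t : torus) : torus :=
  to_torus (int_lin A^T (repr t)).

Lemma congZ2_int_lin (M : 'M[int]_2) (x y : R * R) :
  congZ2 x y -> congZ2 (int_lin M x) (int_lin M y).
Proof.
move=> /andP[xy1 xy2]; apply/andP; split => /=.
  by rewrite opprD addrACA -!mulrBr rpredD// rpredM// intr_int.
by rewrite opprD addrACA -!mulrBr rpredD// rpredM// intr_int.
Qed.

Lemma toral_autE (A : 'M[int]_2) (x : R * R) :
  toral_aut A (to_torus x) = to_torus (int_lin A^T x).
Proof. by apply/to_torusP/congZ2_int_lin/congZ2_repr. Qed.

Lemma measurable_linear_form (a b : R) :
  measurable_fun [set: plane] (fun x : plane => a * x.1 + b * x.2 : R).
Proof.
by apply: measurable_funD; apply: measurable_funM.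
Qed.

Lemma measurable_toral_aut (A : 'M[int]_2) :
  measurable_fun [set: torus] (toral_aut A).
Proof.
apply: measurable_fun_torus.
have -> : toral_aut A \o to_torus = to_torus \o int_lin A^T.
  by apply/funext => x; exact: toral_autE.
apply: (@measurableT_comp _ _ _ _ plane); first exact: measurable_to_torus.
by apply: measurable_fun_pair; exact: measurable_linear_form.
Qed.

HB.instance Definition _ (A : 'M[int]_2) :=
  isMeasurableFun.Build _ _ _ _ (toral_aut A) (measurable_toral_aut A).

(* toral_prod A k is the composite tau_k ... tau_1; A 0 is not used. *)
Fixpoint toral_prod (A : nat -> 'M[int]_2) (k : nat) : torus -> torus :=
  if k is j.+1 then toral_aut (A j.+1) \o toral_prod A j else id.

Lemma measurable_toral_prod (A : nat -> 'M[int]_2) k :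
  measurable_fun [set: torus] (toral_prod A k).
Proof.
elim: k => [|k IH] /=; first exact: measurable_id.
exact: measurableT_comp (measurable_toral_aut _) IH.
Qed.

(* 2 pi <m, x>; on the torus its cosine and sine do not depend on the
   representative (cos_phase and sin_phase). *)
Definition phase (m : int * int) (x : R * R) : R :=
  2 * pi * (m.1%:~R * x.1 + m.2%:~R * x.2).

Lemma phase_shift (m : int * int) (x y : R * R) : congZ2 x y ->
  exists k : nat, phase m x = phase m y + pi *+ 2 *+ k
               \/ phase m y = phase m x + pi *+ 2 *+ k.
Proof.
move=> /andP[/intrP[p xy1] /intrP[q xy2]].
have {xy1 xy2} : phase m x - phase m y = pi *+ 2 * (m.1 * p + m.2 * q)%:~R.
  rewrite /phase -mulrBr opprD addrACA -!mulrBr xy1 xy2 -!intrM -intrD.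
  by rewrite mulr_natl.
case: (m.1 * p + m.2 * q) => k; rewrite mulrzr => /eqP.
  rewrite subr_eq addrC -pmulrn => /eqP E; exists k; by left.
rewrite NegzE mulrNz subr_eq addrC -pmulrn => /eqP E; exists k.+1; right.
by rewrite E subrK.
Qed.

Lemma periodicMn (f : R -> R) (T : R) k :
  (forall x, f (x + T) = f x) -> forall x, f (x + T *+ k) = f x.
Proof.
by move=> fT; elim: k => [|k IH] x; rewrite ?mulr0n ?addr0// mulrSr addrA fT.
Qed.

Lemma cos_phase m (x : R * R) :
  cos (phase m (repr (to_torus x))) = cos (phase m x).
Proof.
by have [k [|] ->] := phase_shift m (congZ2_repr x);
  rewrite (periodicMn _ (@cosD2pi R)).
Qed.

Lemma sin_phase m (x : R * R) :
  sin (phase m (repr (to_torus x))) = sin (phase m x).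
Proof.
by have [k [|] ->] := phase_shift m (congZ2_repr x);
  rewrite (periodicMn _ (@sinD2pi R)).
Qed.

Record trigpoly := Trigpoly {
  freqs : seq (int * int);
  cos_coef : int * int -> R;
  sin_coef : int * int -> R }.

Definition trigpoly_fun (g : trigpoly) (t : torus) : R :=
  \sum_(m <- freqs g) (cos_coef g m * cos (phase m (repr t)) +
                       sin_coef g m * sin (phase m (repr t))).

Lemma measurable_trigpoly (g : trigpoly) :
  measurable_fun [set: torus] (trigpoly_fun g).
Proof.
apply: measurable_fun_sumr => m; apply: measurable_fun_torus.
have mph : measurable_fun [set: plane] (phase m : plane -> R).
  by apply: measurable_funM => //; exact: measurable_linear_form.
rewrite [X in measurable_fun _ X](_ : _ = fun x : plane =>
    cos_coef g m * cos (phase m x) + sin_coef g m * sin (phase m x)).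
  apply: measurable_funD; apply: measurable_funM => //.
    apply: measurableT_comp mph.
    by apply: continuous_measurable_fun; exact: continuous_cos.
  apply: measurableT_comp mph.
  by apply: continuous_measurable_fun; exact: continuous_sin.
by apply/funext => x /=; rewrite cos_phase sin_phase.
Qed.

End torus_def.
Coercion trigpoly_fun : trigpoly >-> Funclass.

Section ergodic_sum.
Variable R : realType.

Definition ergodic_sum (A : nat -> 'M[int]_2) (g : trigpoly R) (n : nat)
    (t : torus R) : R :=
  \sum_(1 <= k < n.+1) g (toral_prod A k t).

Lemma measurable_ergodic_sum A g n :
  measurable_fun [set: torus R] (ergodic_sum A g n).
Proof.
apply: measurable_fun_sumr => k; apply: measurableT_comp.
  exact: measurable_trigpoly.
exact: measurable_toral_prod.
Qed.

HB.instance Definition _ A g n :=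
  isMeasurableFun.Build _ _ _ _ (ergodic_sum A g n)
    (measurable_ergodic_sum A g n).

Definition L2norm (f : torus R -> R) : \bar R :=
  ('N[@lebesgue_torus R]_(2%:E) [EFin \o f])%E.

Definition normalized_sum A (g : trigpoly R) n (t : torus R) : R :=
  ergodic_sum A g n t / fine (L2norm (ergodic_sum A g n)).

HB.instance Definition _ A g n := MeasurableFun.copy (normalized_sum A g n)
  ((fine (L2norm (ergodic_sum A g n)))^-1 \o* ergodic_sum A g n).

End ergodic_sum.

(* The two variables may live on different probability spaces. *)
Definition kolmogorov_dist d1 d2 (T1 : measurableType d1)
    (T2 : measurableType d2) (R : realType) (P : probability T1 R)
    (Q : probability T2 R) (X : {RV P >-> R}) (Y : {RV Q >-> R}) : R :=
  sup [set `|fine (cdf X x) - fine (cdf Y x)| | x in [set: R]].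
Arguments kolmogorov_dist {d1 d2 T1 T2 R} P Q X Y.

(* Main.v *)
From HB Require Import structures.
Require Import Defs.
From mathcomp Require Import all_boot all_order all_algebra.
From mathcomp Require Import all_classical all_reals all_analysis.
From mathcomp Require Import measurable_realfun.
From mathcomp Require Import ring lra zify.
Import Order.TTheory GRing.Theory Num.Theory.
Import numFieldNormedType.Exports.
Local Open Scope classical_set_scope.
Local Open Scope ring_scope.
Set Implicit Arguments.
Unset Strict Implicit.
Unset Printing Implicit Defensive.

(** Write the polynomial as a sum of waves [c * cos (2 pi <m, t> + th)] with [m]
    nonzero. Composing with [tau_k ... tau_1] changes the frequency [m] into
    [A_1 ... A_k m], and positive matrices of determinant one make these frequencies
    grow: as long as a vector stays outside the positive cone and its opposite, every
    step at least halves its length, so that a nonzero integer vector enters the cone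
    after a number of steps logarithmic in its length, and from then on every step at
    least doubles its coordinates ([freq_enters_cone], [freq_fst_growth]). Hence the sum
    [S_n] behaves like a lacunary trigonometric series.

    The first coordinate of [A_1 ... A_k m] is large compared with the horizontal
    Lipschitz constant of any smooth function [F] of the sum [S_p] when [k - p] is
    large. Translating by half a wavelength changes the sign of the wave and hardly
    changes [F], so that the mean of [F] times the wave is small ([mean_wave_le]). This
    gives the three facts used on the sequence: terms far apart are exactly orthogonal
    ([mean_wsum_mul0]); a term is nearly centred given the sum stopped [e] steps
    before, up to an error of order [2 ^ - e] ([mean_mul_wsum_le]); a product of two
    terms at distance [d] has nearly its mean value given the sum stopped a multiple of
    [d] steps before ([decorr_wsum_mul]).

    The central limit theorem then follows from a replacement argument which only goes
    forward in time. Let [Phi] be the Gaussian distribution function, [V_k] the variance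
    of the [k]-th normalized partial sum [S_k / s], with [s] the norm of [S_n], and
    consider the means of [Phi ((a - S_k / s) / sqrt (eps ^ 2 + 1 - V_k))]. For [k = 0]
    this is nearly [Phi a], and for [k = n] it is the distribution function of [S_n / s]
    smoothed at scale [eps]. Between [k] and [k + 1], expand to the second order around
    sums stopped somewhat earlier: the first order term vanishes nearly, the mean of the
    second order term is half of the increment of [V_k], and it is cancelled by the
    change of time, because [Phi (y / sqrt tau)] solves the heat equation
    ([lindeberg_pointwise], [smooth_step], [clt_smoothed]). The variances [V_k]
    may decrease, but by so little that the time stays positive ([var_almost_mono]).

    Finally the smoothing is removed by shifting the threshold ([cdf_smoothing]). With
    [q] the integer part of the root of order 32 of [n], smoothing at scale [q ^ -2],
    shift [1 / q] and windows of length proportional to [q], every error is at most a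
    constant times [1 / q]. *)

(** * The Gaussian distribution function and the heat kernel *)

(** Derivation rules in the pointwise form [fun y => ...], which is how the
    functions of the proof are written. *)
Section pointwise_derivatives.
Context {R : realType}.
Implicit Types (f g : R -> R) (x : R).

Lemma isd_eq f x a b : is_derive x 1 f a -> a = b -> is_derive x 1 f b.
Proof. by move=> H <-. Qed.

Lemma isdD f g x a b : is_derive x 1 f a -> is_derive x 1 g b ->
  is_derive x 1 (fun y => f y + g y) (a + b).
Proof. by move=> H1 H2; exact: is_deriveD. Qed.

Lemma isdN f x a : is_derive x 1 f a -> is_derive x 1 (fun y => - f y) (- a).
Proof. by move=> H1; exact: is_deriveN. Qed.

Lemma isdB f g x a b : is_derive x 1 f a -> is_derive x 1 g b ->
  is_derive x 1 (fun y => f y - g y) (a - b).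
Proof. by move=> H1 H2; exact: is_deriveB. Qed.

Lemma isdM f g x a b : is_derive x 1 f a -> is_derive x 1 g b ->
  is_derive x 1 (fun y => f y * g y) (f x * b + g x * a).
Proof. by move=> H1 H2; exact: is_deriveM. Qed.

Lemma isd_cst c x : is_derive x 1 (fun=> c : R) 0.
Proof. exact: is_derive_cst. Qed.

Lemma isd_id x : is_derive x 1 (fun y => y) 1.
Proof. exact: is_derive_id. Qed.

Lemma isdZ c f x a : is_derive x 1 f a -> is_derive x 1 (fun y => c * f y) (c * a).
Proof. by move=> H; apply: isd_eq (isdM (isd_cst c x) H) _; rewrite mulr0 addr0. Qed.

Lemma isd_comp f g x a b : is_derive (g x) 1 f a -> is_derive x 1 g b ->
  is_derive x 1 (fun y => f (g y)) (b * a).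
Proof.
move=> H1 H2; apply: isd_eq (@is_derive1_comp R f g x a b H1 H2) _.
by rewrite mulrC.
Qed.

Lemma isd_continuous f df : (forall x, is_derive x 1 f (df x)) -> continuous f.
Proof.
by move=> H x; apply/differentiable_continuous/derivable1_diffP; have [] := H x.
Qed.

Lemma mvt_bound f df (B a b : R) :
  (forall x, Num.min a b <= x <= Num.max a b -> is_derive x 1 f (df x)) ->
  (forall x, Num.min a b <= x <= Num.max a b -> `|df x| <= B) ->
  `|f b - f a| <= B * `|b - a|.
Proof.
wlog ab : a b / a <= b => [wl H1 H2|H1 H2].
  have [ab|/ltW ba] := leP a b; first exact: wl.
  by rewrite distrC (distrC b); apply: wl => // x; rewrite minC maxC; [exact: H1|exact: H2].
move: H1 H2; rewrite min_l // max_r // => H1 H2.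
have [c cab ->] : exists2 c, c \in `[a, b] & f b - f a = df c * (b - a).
  apply: MVT_segment; first exact: ab.
    by move=> c; rewrite in_itv /= => /andP[c1 c2]; apply: H1; rewrite !ltW.
  apply: derivable_within_continuous => x xab.
  by have [] : is_derive x 1 f (df x) by apply: H1; rewrite in_itv in xab.
by rewrite normrM ler_wpM2r //; apply: H2; rewrite in_itv in cab.
Qed.

Lemma mvt_boundT f df (B a b : R) : (forall x, is_derive x 1 f (df x)) ->
  (forall x, `|df x| <= B) -> `|f b - f a| <= B * `|b - a|.
Proof. by move=> H1 H2; apply: mvt_bound. Qed.

End pointwise_derivatives.

Section gaussian_cdf.
Context {R : realType}.
Implicit Types x y z w tau : R.

(** The standard Gaussian density and its first two derivatives. *)
Definition gd x : R := normal_peak 1 * expR (- (x ^+ 2 / 2)).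
Definition gd1 x : R := - (x * gd x).
Definition gd2 x : R := (x ^+ 2 - 1) * gd x.
Definition Phi x : R := fine (normal_prob (0 : R) 1 `]-oo, x]).

Lemma normal_pdf01 : normal_pdf (0 : R) 1 = gd.
Proof.
rewrite normal_pdfE ?oner_neq0 //; apply/funext => x; rewrite /gd /normal_fun.
by rewrite subr0 expr1n mulNr.
Qed.

Lemma gd_ge0 x : 0 <= gd x.
Proof. by rewrite mulr_ge0 ?expR_ge0 ?normal_peak_ge0. Qed.

Lemma gd_le1 x : gd x <= 1.
Proof.
rewrite /gd -[leRHS]mulr1; apply: ler_pM; rewrite ?expR_ge0 ?normal_peak_ge0 //.
  rewrite /normal_peak invf_le1 ?sqrtr_gt0.
    rewrite -[leLHS]sqrtr1 ler_wsqrtr // expr1n mul1r mulr2n.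
    have := @pi_ge2 R; lra.
  by rewrite expr1n mul1r mulr2n; have := @pi_gt0 R; lra.
by rewrite -expR0 ler_expR oppr_le0 divr_ge0 ?sqr_ge0.
Qed.

Lemma x4gd_le x : x ^+ 4 * gd x <= 8.
Proof.
have p1 : gd 0 <= 1 := gd_le1 0.
rewrite /gd expr0n /= mul0r oppr0 expR0 mulr1 in p1.
have p0 : 0 <= normal_peak 1 :> R := normal_peak_ge0 1.
have u0 : 0 <= x ^+ 2 / 2 by rewrite divr_ge0 ?sqr_ge0.
rewrite /gd expRN (_ : x ^+ 4 = 4 * (x ^+ 2 / 2) ^+ 2); last by field.
set u := x ^+ 2 / 2 in u0 *.
have eu := expR_ge1Dxn 1 u0.
have e0 := expR_gt0 u.
rewrite mulrA ler_pdivrMr //.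
have u2 : 0 <= u ^+ 2 by rewrite sqr_ge0.
rewrite (_ : (2`!)%:R = 2) // in eu.
have : 4 * u ^+ 2 * normal_peak 1 <= 4 * u ^+ 2 * 1 by rewrite ler_wpM2l //; lra.
lra.
Qed.

(** All the derivatives used below are bounded because they are a polynomial of
    degree at most [4] times [gd]. *)
Lemma absXgd_le k x : (k <= 4)%N -> `|x| ^+ k * gd x <= 9.
Proof.
move=> k4; have g0 := gd_ge0 x; have g1 := gd_le1 x; have g4 := x4gd_le x.
have : `|x| ^+ k <= 1 + x ^+ 4.
  have x4 : x ^+ 4 = `|x| ^+ 4 by rewrite -normrX ger0_norm // exprn_even_ge0.
  have [x1|/ltW x1] := leP `|x| 1.
    apply: (@le_trans _ _ 1); first by rewrite exprn_ile1.
    by rewrite lerDl x4 exprn_ge0.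
  by rewrite (@le_trans _ _ (`|x| ^+ 4)) // ?x4 ?lerDr // ler_weXn2l.
move=> h; have := ler_wpM2r g0 h; lra.
Qed.

Lemma gd1_bound x : `|gd1 x| <= 9.
Proof.
by rewrite normrN normrM (ger0_norm (gd_ge0 x)) -[`|x|]expr1; exact: absXgd_le.
Qed.

Lemma gd2_bound x : `|gd2 x| <= 10.
Proof.
have g0 := gd_ge0 x; have g1 := gd_le1 x; have := @absXgd_le 2 x isT.
rewrite real_normK ?num_real // => h.
have q0 : 0 <= x ^+ 2 * gd x by rewrite mulr_ge0 ?sqr_ge0.
by rewrite /gd2 mulrBl mul1r ler_norml; lra.
Qed.

Lemma xgd2_bound x : `|x * gd2 x| <= 18.
Proof.
have g0 := gd_ge0 x; have h1 := @absXgd_le 1 x isT; have h3 := @absXgd_le 3 x isT.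
rewrite (_ : x * gd2 x = x ^+ 3 * gd x - x * gd x); last by rewrite /gd2; ring.
apply: le_trans (ler_normB _ _) _.
rewrite (normrM (x ^+ 3)) normrX (normrM x) (ger0_norm g0).
by rewrite expr1 in h1; lra.
Qed.

Lemma is_derive_gd x : is_derive x 1 gd (gd1 x).
Proof.
have h : is_derive x 1 (fun y => - (y ^+ 2 / 2)) (- x).
  rewrite (_ : (fun y => _) = fun y => - 2^-1 * (y * y)); last first.
    by apply/funext => y; field.
  apply: isd_eq (isdZ (- 2^-1) (isdM (isd_id x) (isd_id x))) _; by field.
apply: isd_eq (isdZ (normal_peak 1) (isd_comp (is_derive_expR _) h)) _.
by rewrite /gd1 /gd; ring.
Qed.

Lemma is_derive_gd1 x : is_derive x 1 gd1 (gd2 x).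
Proof.
apply: isd_eq (isdN (isdM (isd_id x) (is_derive_gd x))) _.
by rewrite /gd2 /gd1; ring.
Qed.

Lemma continuous_gd : continuous gd.
Proof. exact: isd_continuous is_derive_gd. Qed.

Lemma continuous_gd1 : continuous gd1.
Proof. exact: isd_continuous is_derive_gd1. Qed.

Lemma is_derive_Phi x : is_derive x 1 Phi (gd x).
Proof.
have H : lebesgue_measure.-integrable [set` Interval -oo%O (BRight (x + 1))] (EFin \o gd).
  apply: (@integrableS _ _ _ _ setT) => //.
  by rewrite -normal_pdf01; exact: (integrable_normal_pdf 0 1).
have xx : x < x + 1 by rewrite ltrDl.
have [D E] := @continuous_FTC1 R gd -oo%O x _ xx H (ltNyr x) (@continuous_gd x).
have PE : Phi = fun y => \int[lebesgue_measure]_(t in [set` Interval -oo%O (BRight y)]) gd t.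
  by apply/funext => y; rewrite /Phi /normal_prob normal_pdf01.
by rewrite PE; split; [exact: D | rewrite -derive1E; exact: E].
Qed.

Lemma continuous_Phi : continuous Phi.
Proof. exact: isd_continuous is_derive_Phi. Qed.

Lemma Phi_ge0 x : 0 <= Phi x.
Proof. exact: fine_ge0. Qed.

Lemma Phi_le1 x : Phi x <= 1.
Proof.
rewrite -lee_fin /Phi fineK; first exact: probability_le1.
exact: fin_num_measure.
Qed.

Lemma le_Phi x y : x <= y -> Phi x <= Phi y.
Proof.
move=> xy; apply: fine_le; rewrite ?fin_num_measure //.
by apply: le_measure; rewrite ?inE //; apply: subset_itvl; rewrite bnd_simp.
Qed.

(** Since [x ^ 2 * gd x] is at most [9], adding [9 / x] to a primitive of [gd]
    makes it nonincreasing on the positive axis. *)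
Lemma gd_primitive_tail (F : R -> R) z y : (forall x, is_derive x 1 F (gd x)) ->
  0 < z -> z <= y -> F y - F z <= 9 / z.
Proof.
move=> DF z0 zy; have y0 : 0 < y := lt_le_trans z0 zy.
have D x : 0 < x -> is_derive x 1 (fun x => F x + 9 * x^-1) (gd x - 9 / x ^+ 2).
  move=> x0; apply: isd_eq (isdD (DF x) (isdZ 9 _)) _.
    exact: (is_deriveV (lt0r_neq0 x0) (is_derive_id x 1)).
  rewrite /= -[_ *: 1]/(_ * 1) mulr1; field; exact: lt0r_neq0.
have [c czy] : exists2 c, c \in `[z, y] & (F y + 9 * y^-1) - (F z + 9 * z^-1)
    = (gd c - 9 / c ^+ 2) * (y - z).
  apply: (@MVT_segment R (fun x => F x + 9 * x^-1) (fun c => gd c - 9 / c ^+ 2)); first exact: zy.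
    by move=> c; rewrite in_itv /= => /andP[c1 _]; apply: D; exact: lt_trans c1.
  apply: derivable_within_continuous => x; rewrite in_itv /= => /andP[x1 _].
  by have [] := D x (lt_le_trans z0 x1).
move: czy; rewrite in_itv /= => /andP[zc _].
have c0 : 0 < c := lt_le_trans z0 zc.
have : (gd c - 9 / c ^+ 2) * (y - z) <= 0.
  apply: mulr_le0_ge0; last by rewrite subr_ge0.
  rewrite subr_le0 ler_pdivlMr ?exprn_gt0 // mulrC.
  by have := @absXgd_le 2 c isT; rewrite ger0_norm // ltW.
have : 0 < 9 / y by rewrite divr_gt0.
lra.
Qed.

Lemma Phi_cvg : Phi x @[x --> +oo] --> (1 : R) /\ Phi x @[x --> -oo] --> (0 : R).
Proof.
pose idm := isMeasurableFun.Build _ _ (measurableTypeR R) R idfun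
  (@measurable_id _ (measurableTypeR R) setT).
pose X : {RV (normal_prob (0 : R) 1) >-> R} := HB.pack idfun idm.
split.
  exact: (@fine_cvg _ _ _ _ (cdf X) 1 (cvg_cdfy1 X)).
exact: (@fine_cvg _ _ _ _ (cdf X) 0 (cvg_cdfNy0 X)).
Qed.

Lemma Phi_upper_tail z : 0 < z -> 1 - Phi z <= 9 / z.
Proof.
move=> z0; rewrite lerBlDr; apply: (cvgr_to_le Phi_cvg.1).
near=> y; rewrite -lerBlDr; apply: gd_primitive_tail; [exact: is_derive_Phi|exact: z0|].
by near: y; apply: nbhs_pinfty_ge; exact: num_real.
Unshelve. all: by end_near. Qed.

Lemma Phi_lower_tail z : 0 < z -> Phi (- z) <= 9 / z.
Proof.
move=> z0; rewrite -subr_le0; apply: (cvgr_to_ge Phi_cvg.2).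
have DF x : is_derive x 1 (fun s : R => - Phi (- s)) (gd x).
  have h : is_derive x 1 (fun s : R => - s) (-1) by apply: isdN (isd_id x).
  apply: isd_eq (isdN (isd_comp (is_derive_Phi (- x)) h)) _.
  by rewrite mulN1r opprK /gd sqrrN.
near=> y.
have zy : z <= - y.
  by rewrite lerNr; near: y; apply: nbhs_ninfty_le; exact: num_real.
have := gd_primitive_tail DF z0 zy; rewrite opprK; lra.
Unshelve. all: by end_near. Qed.

Lemma gd1_lip z w : `|gd1 (z + w) - gd1 z| <= 10 * `|w|.
Proof.
by have := mvt_boundT z (z + w) is_derive_gd1 gd2_bound; rewrite addrAC subrr add0r.
Qed.

Lemma gd_lip z w : `|gd (z + w) - gd z| <= 9 * `|w|.
Proof.
by have := mvt_boundT z (z + w) is_derive_gd gd1_bound; rewrite addrAC subrr add0r.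
Qed.

Lemma Phi_lip z w : `|Phi (z + w) - Phi z| <= `|w|.
Proof.
rewrite -[leRHS]mul1r.
have := mvt_boundT (B := 1) z (z + w) is_derive_Phi.
by rewrite addrAC subrr add0r; apply => x; rewrite ger0_norm ?gd_ge0 ?gd_le1.
Qed.

Lemma between0 w x : Num.min 0 w <= x <= Num.max 0 w -> `|x| <= `|w|.
Proof.
by have [w0|w0] := leP 0 w => /andP[h1 h2]; [rewrite !ger0_norm|rewrite !ler0_norm]; lra.
Qed.

Lemma is_derive_shifted (f : R -> R) z (s a : R) :
  is_derive (z + s) 1 f a -> is_derive s 1 (fun s => f (z + s)) a.
Proof.
move=> H; have h : is_derive s 1 (fun s => z + s) 1.
  by apply: isd_eq (isdD (isd_cst z s) (isd_id s)) _; rewrite add0r.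
by apply: isd_eq (isd_comp H h) _; rewrite mul1r.
Qed.

(** Integrating the Lipschitz bound of one derivative gives the Taylor expansion
    of the previous one, with no further smoothness argument. *)
Lemma gd_taylor z w : `|gd (z + w) - gd z - w * gd1 z| <= 10 * w ^+ 2.
Proof.
have D (s : R) : is_derive s 1 (fun s => gd (z + s) - s * gd1 z) (gd1 (z + s) - gd1 z).
  apply: isd_eq (isdB (is_derive_shifted (is_derive_gd _))
    (isdM (isd_id s) (isd_cst (gd1 z) s))) _.
  by rewrite mulr0 add0r mulr1.
have := @mvt_bound _ _ _ (10 * `|w|) 0 w (fun s _ => D s).
rewrite addr0 mul0r !subr0 -mulrA -expr2 real_normK ?num_real //.
rewrite (_ : _ - _ - gd z = gd (z + w) - gd z - w * gd1 z); last by ring.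
apply=> s /between0 sw; apply: le_trans (gd1_lip _ _) _.
by rewrite ler_wpM2l.
Qed.

Lemma Phi_taylor z w :
  `|Phi (z + w) - Phi z - w * gd z - w ^+ 2 / 2 * gd1 z| <= 10 * `|w| ^+ 3.
Proof.
have D (s : R) : is_derive s 1 (fun s => Phi (z + s) - s * gd z - (s * s) * (gd1 z / 2))
    (gd (z + s) - gd z - s * gd1 z).
  apply: isd_eq (isdB (isdB (is_derive_shifted (is_derive_Phi _))
    (isdM (isd_id s) (isd_cst (gd z) s)))
    (isdM (isdM (isd_id s) (isd_id s)) (isd_cst (gd1 z / 2) s))) _.
  by field.
have := @mvt_bound _ _ _ (10 * `|w| ^+ 2) 0 w (fun s _ => D s).
rewrite addr0 !mul0r !subr0 -(mulrA 10) -exprSr.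
rewrite (_ : _ - _ - _ - Phi z =
  Phi (z + w) - Phi z - w * gd z - w ^+ 2 / 2 * gd1 z); last by field.
apply=> s /between0 sw; apply: le_trans (gd_taylor _ _) _.
by rewrite ler_wpM2l // -real_normK ?num_real // lerXn2r.
Qed.

(** [Phi (y / Num.sqrt tau)] solves the heat equation in [y] and [tau]: its time
    derivative is half of its second space derivative [gd1 (y / Num.sqrt tau) / tau].
    This identity is what cancels the second order terms in the replacement step. *)
Lemma Phi_time_derive y tau : 0 < tau ->
  is_derive tau 1 (fun tau => Phi (y / Num.sqrt tau))
    (gd1 (y / Num.sqrt tau) / (2 * tau)).
Proof.
move=> t0; have s0 : 0 < Num.sqrt tau by rewrite sqrtr_gt0.
have Hs := is_derive1_sqrt t0.
have Hv := is_deriveV (lt0r_neq0 s0) Hs.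
apply: isd_eq (isd_comp (is_derive_Phi _) (isdZ y Hv)) _.
rewrite -[_ *: _]/(_ * _) /gd1.
rewrite -[X in _ = _ / (2 * X)](@sqr_sqrtr _ tau) ?ltW //.
by field; exact: lt0r_neq0.
Qed.

Lemma Phi_time_derive2 y tau : 0 < tau ->
  is_derive tau 1 (fun tau => gd1 (y / Num.sqrt tau) / (2 * tau))
    (- (y / Num.sqrt tau * gd2 (y / Num.sqrt tau) + 2 * gd1 (y / Num.sqrt tau))
      / (4 * tau ^+ 2)).
Proof.
move=> t0; have s0 : 0 < Num.sqrt tau by rewrite sqrtr_gt0.
have Hs := is_derive1_sqrt t0.
have Hv := is_deriveV (lt0r_neq0 s0) Hs.
have Ht := is_deriveV (lt0r_neq0 (_ : 0 < 2 * tau)) (isdZ 2 (isd_id tau)).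
apply: isd_eq (isdM (isd_comp (is_derive_gd1 _) (isdZ y Hv)) (Ht _)) _.
  by rewrite mulr_gt0.
rewrite -![_ *: _]/(_ * _).
rewrite -[tau in RHS](@sqr_sqrtr _ tau) ?ltW //.
rewrite -[tau in (2 * tau)](@sqr_sqrtr _ tau) ?ltW //.
by rewrite sqrtr_sqr gtr0_norm //; field; exact: lt0r_neq0.
Qed.

Lemma Phi_time_lip y m tau tau' : 0 < m -> m <= tau -> m <= tau' ->
  `|Phi (y / Num.sqrt tau') - Phi (y / Num.sqrt tau)| <= 5 / m * `|tau' - tau|.
Proof.
move=> m0 mt mt'.
have ge_m x : Num.min tau tau' <= x <= Num.max tau tau' -> m <= x.
  by move=> /andP[+ _]; apply: le_trans; rewrite le_min mt.
apply: (@mvt_bound R (fun tau => Phi (y / Num.sqrt tau))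
  (fun tau => gd1 (y / Num.sqrt tau) / (2 * tau))).
  by move=> x /ge_m mx; apply: Phi_time_derive; exact: lt_le_trans mx.
move=> x /ge_m mx; have x0 : 0 < x by exact: lt_le_trans mx.
rewrite normrM normfV (gtr0_norm (_ : 0 < 2 * x)) ?mulr_gt0 //.
rewrite ler_pdivrMr ?mulr_gt0 //.
have := gd1_bound (y / Num.sqrt x).
have : 5 <= 5 / m * x by rewrite mulrAC ler_pdivlMr // ler_wpM2l.
lra.
Qed.

Lemma Phi_time_taylor y m tau tau' : 0 < m -> m <= tau -> m <= tau' ->
  `|Phi (y / Num.sqrt tau') - Phi (y / Num.sqrt tau)
    - (tau' - tau) * (gd1 (y / Num.sqrt tau) / (2 * tau))|
  <= 9 / m ^+ 2 * (tau' - tau) ^+ 2.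
Proof.
move=> m0 mt mt'.
pose D1 tau := gd1 (y / Num.sqrt tau) / (2 * tau).
have ge_m x : Num.min tau tau' <= x <= Num.max tau tau' -> m <= x.
  by move=> /andP[+ _]; apply: le_trans; rewrite le_min mt.
have D1lip x : Num.min tau tau' <= x <= Num.max tau tau' ->
    `|D1 x - D1 tau| <= 9 / m ^+ 2 * `|tau' - tau|.
  move=> /[dup] xb /ge_m mx.
  apply: (@le_trans _ _ (9 / m ^+ 2 * `|x - tau|)); last first.
    apply: ler_wpM2l; first by rewrite divr_ge0 // exprn_ge0 // ltW.
    move: xb; have [tt|tt] := leP tau tau' => /andP[h1 h2];
      [rewrite !ger0_norm|rewrite !ler0_norm]; lra.
  apply: (@mvt_bound R D1 (fun tau => - (y / Num.sqrt tau * gd2 (y / Num.sqrt tau)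
      + 2 * gd1 (y / Num.sqrt tau)) / (4 * tau ^+ 2))) => u ub.
    apply: Phi_time_derive2; apply: (lt_le_trans m0).
    by move: ub => /andP[+ _]; apply: le_trans; rewrite le_min mt.
  have mu : m <= u by move: ub => /andP[+ _]; apply: le_trans; rewrite le_min mt.
  have u0 : 0 < u by exact: lt_le_trans mu.
  have u2 : 0 < u ^+ 2 by rewrite exprn_gt0.
  rewrite normrM normfV normrN (gtr0_norm (_ : 0 < 4 * u ^+ 2)) ?mulr_gt0 //.
  rewrite ler_pdivrMr ?mulr_gt0 //.
  apply: (le_trans (ler_normD _ _)).
  rewrite (normrM 2) (@ger0_norm _ 2) //.
  have := gd1_bound (y / Num.sqrt u); have := xgd2_bound (y / Num.sqrt u).
  have : 9 <= 9 / m ^+ 2 * u ^+ 2.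
    rewrite mulrAC ler_pdivlMr ?exprn_gt0 // ler_wpM2l // lerXn2r // nnegrE ltW //.
  lra.
have D (u : R) : 0 < u -> is_derive u 1 (fun u => Phi (y / Num.sqrt u) - (u - tau) * D1 tau)
    (D1 u - D1 tau).
  move=> u0; apply: isd_eq (isdB (Phi_time_derive y u0)
    (isdM (isdB (isd_id u) (isd_cst tau u)) (isd_cst (D1 tau) u))) _.
  by rewrite mulr0 subr0 mulr1 add0r.
have := @mvt_bound _ _ _ (9 / m ^+ 2 * `|tau' - tau|) tau tau'
  (fun u ub => D u (lt_le_trans m0 (ge_m u ub))) D1lip.
rewrite subrr mul0r subr0 -(mulrA (9 / m ^+ 2)) -expr2 real_normK ?num_real //.
by rewrite addrAC.
Qed.

End gaussian_cdf.

(** * Growth of the frequencies under positive matrices *)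

Section positive_products.
Implicit Types (M : 'M[int]_2) (u v w : int * int).

Definition mact M v : int * int :=
  (M 0 0 * v.1 + M 0 1 * v.2, M 1 0 * v.1 + M 1 1 * v.2).

Definition posSL2 M := \det M = 1 /\ forall i j : 'I_2, 0 < M i j.

Definition nrm1 v : int := `|v.1| + `|v.2|.

(** Both coordinates have the same sign and are at least [c] in absolute value;
    for [c = 0] this is the closed positive quadrant and its opposite. *)
Definition cone (c : int) v :=
  (c <= v.1) && (c <= v.2) || (v.1 <= - c) && (v.2 <= - c).

Lemma mactD M v w : mact M (v + w) = mact M v + mact M w.
Proof. by rewrite /mact /=; congr (_, _) => /=; ring. Qed.

Lemma mactN M v : mact M (- v) = - mact M v.
Proof. by rewrite /mact /=; congr (_, _) => /=; ring. Qed.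

Lemma posSL2_det M : posSL2 M -> M 0 0 * M 1 1 - M 0 1 * M 1 0 = 1.
Proof.
move=> [<- _]; rewrite (expand_det_row M 0) !big_ord_recl big_ord0 addr0.
rewrite /cofactor !det_mx11 !mxE.
have l1 : lift ord0 (0 : 'I_1) = 1 :> 'I_2 by apply: val_inj.
have l2 : lift ord0 (ord0 : 'I_1) = 1 :> 'I_2 by apply: val_inj.
have l0 : lift (1 : 'I_2) (0 : 'I_1) = 0 by apply: val_inj.
rewrite !l1 ?l2 l0 !add0n; change (nat_of_ord (1 : 'I_2)) with 1%N.
by rewrite expr0 expr1 mul1r mulN1r mulrN.
Qed.


Lemma pair_neq0 v : (v != 0) = (v.1 != 0) || (v.2 != 0).
Proof. by case: v => a b; rewrite xpair_eqE negb_and. Qed.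

Lemma mact_neq0 M v : posSL2 M -> v != 0 -> mact M v != 0.
Proof.
move=> hM; apply: contra_neq => /eqP; rewrite xpair_eqE => /andP[/eqP e1 /eqP e2].
have d := posSL2_det hM.
have h1 : v.1 = 0.
  have : M 1 1 * (M 0 0 * v.1 + M 0 1 * v.2) - M 0 1 * (M 1 0 * v.1 + M 1 1 * v.2)
    = (M 0 0 * M 1 1 - M 0 1 * M 1 0) * v.1 by ring.
  by rewrite e1 e2 d !mulr0 subr0 mul1r.
have h2 : v.2 = 0.
  have : M 0 0 * (M 1 0 * v.1 + M 1 1 * v.2) - M 1 0 * (M 0 0 * v.1 + M 0 1 * v.2)
    = (M 0 0 * M 1 1 - M 0 1 * M 1 0) * v.2 by ring.
  by rewrite e1 e2 d !mulr0 subr0 mul1r.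
by case: v h1 h2 {e1 e2} => a b /= -> ->.
Qed.

Lemma mact_cone0 M v : posSL2 M -> cone 0 v -> v != 0 -> cone 1 (mact M v).
Proof.
move=> [_ pM]; rewrite pair_neq0 /cone oppr0 /mact /=.
have := pM 0 0; have := pM 0 1; have := pM 1 0; have := pM 1 1.
move: (M 0 0) (M 0 1) (M 1 0) (M 1 1) => a b c d d0 c0 b0 a0.
by case: v => x y /=; nia.
Qed.

Lemma mact_cone M v (c : int) : posSL2 M -> 0 <= c -> cone c v -> cone (2 * c) (mact M v).
Proof.
move=> [_ pM] c0; rewrite /cone /mact /=.
have := pM 0 0; have := pM 0 1; have := pM 1 0; have := pM 1 1.
move: (M 0 0) (M 0 1) (M 1 0) (M 1 1) => a b d e e0 d0 b0 a0.
case: v => x y /= /orP[] /andP[hx hy]; apply/orP; [left|right]; apply/andP; split; nia.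
Qed.

(** The inverse of a positive matrix of determinant one at least doubles the length of
    every vector outside the closed positive cone and its opposite. *)
Lemma mact_mixed M v : posSL2 M -> ~~ cone 0 (mact M v) -> 2 * nrm1 (mact M v) <= nrm1 v.
Proof.
move=> hM; have d := posSL2_det hM; case: hM => _ pM.
have E : v = (M 1 1 * (mact M v).1 - M 0 1 * (mact M v).2,
                  M 0 0 * (mact M v).2 - M 1 0 * (mact M v).1).
  rewrite /mact /=; case: v => x y /=; congr (_, _).
    rewrite (_ : _ - _ = (M 0 0 * M 1 1 - M 0 1 * M 1 0) * x); last by ring.
    by rewrite d mul1r.
  rewrite (_ : _ - _ = (M 0 0 * M 1 1 - M 0 1 * M 1 0) * y); last by ring.
  by rewrite d mul1r.
rewrite [X in _ <= nrm1 X]E; move: (mact M v) => {v E} [x y]; rewrite /cone /nrm1 /= oppr0.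
have := pM 0 0; have := pM 0 1; have := pM 1 0; have := pM 1 1.
move: (M 0 0) (M 0 1) (M 1 0) (M 1 1) {d pM} => a b c d d0 c0 b0 a0.
rewrite negb_or !negb_and -!ltNge => /andP[h1 h2].
have [x0|x0] := ltP x 0.
  have y0 : 0 < y by move: h2; rewrite !ltNge; lia.
  have : d * x - b * y <= x - y by nia.
  have : a * y - c * x >= y - x by nia.
  lia.
have y0 : y < 0 by move: h1; rewrite !ltNge; lia.
have : d * x - b * y >= x - y by nia.
have : a * y - c * x <= y - x by nia.
lia.
Qed.

(** [freq A p d v] is the vector [A_(p+1) ... A_(p+d) v]; the wave of frequency
    [v] composed with [tau_d ... tau_1] is the wave of frequency [freq A 0 d v]. *)
Fixpoint freq (A : nat -> 'M[int]_2) p d v : int * int :=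
  if d is e.+1 then freq A p e (mact (A (p + d)%N) v) else v.

Lemma freqD A p d v w : freq A p d (v + w) = freq A p d v + freq A p d w.
Proof. by elim: d v w => //= d IH v w; rewrite mactD IH. Qed.

Lemma freqN A p d v : freq A p d (- v) = - freq A p d v.
Proof. by elim: d v => //= d IH v; rewrite mactN IH. Qed.

Lemma freq0 A p d : freq A p d 0 = 0.
Proof. by elim: d => //= d IH; rewrite /mact /= !mulr0 addr0. Qed.

Lemma freq_cat A p d e v : freq A p (d + e) v = freq A p d (freq A (p + d) e v).
Proof.
elim: e v => [|e IH] v; first by rewrite addn0.
by rewrite addnS /= IH addnS addnA addnS.
Qed.

Section growth.
Variables (A : nat -> 'M[int]_2) (posA : forall k, (1 <= k)%N -> posSL2 (A k)).

Lemma freq_neq0 p d v : v != 0 -> freq A p d v != 0.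
Proof.
elim: d v => //= d IH v v0; apply: IH; apply: mact_neq0 => //.
by apply: posA; rewrite addnS.
Qed.

Lemma freq_cone p d v (c : int) : 0 <= c -> cone c v -> cone (2 ^+ d * c) (freq A p d v).
Proof.
elim: d v c => [|d IH] v c c0 cv /=; first by rewrite expr0 mul1r.
rewrite exprSr -mulrA; apply: IH; first by rewrite mulr_ge0.
by apply: mact_cone => //; apply: posA; rewrite addnS.
Qed.

(** A nonzero vector shorter than [2 ^ r] cannot stay outside the cone for [r]
    steps, each of which would halve its length. *)
Lemma freq_enters_cone p r v : v != 0 -> nrm1 v < 2 ^+ r -> cone 1 (freq A p r.+1 v).
Proof.
have from_cone0 q s u : cone 0 u -> u != 0 -> cone 1 (freq A q s.+1 u).
  move=> cu u0; have hA : posSL2 (A (q + s.+1)) by apply: posA; rewrite addnS.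
  have := freq_cone q s (ler01 : 0 <= 1 :> int) (mact_cone0 hA cu u0).
  rewrite mulr1 /cone /=.
  have : 1 <= 2 ^+ s :> int by rewrite exprn_ege1.
  by move: (freq _ _ _ _) => [x y] /=; lia.
elim: r v => [|r IH] v v0 vr.
  move: v0 vr; rewrite pair_neq0 expr0 /nrm1; case: v => x y /=; lia.
have [cv|ncv] := boolP (cone 0 v); first exact: from_cone0.
have hA : posSL2 (A (p + r.+2)) by apply: posA; rewrite addnS.
change (freq A p r.+2 v) with (freq A p r.+1 (mact (A (p + r.+2)) v)).
have u0 := mact_neq0 hA v0.
have [cu|ncu] := boolP (cone 0 (mact (A (p + r.+2)) v)); first exact: from_cone0.
apply: IH => //; have := mact_mixed hA ncu; rewrite exprS in vr; lia.
Qed.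

(** The sum of the first row of [A_1 ... A_p], the unit in which the first
    coordinates of all later frequencies are measured. *)
Definition rowsum p : int := (freq A 0 p (1, 1)).1.

Lemma freq_fst p : exists a b : int, [/\ 0 <= a, 0 <= b, a + b = rowsum p &
  forall v, (freq A 0 p v).1 = a * v.1 + b * v.2].
Proof.
rewrite /rowsum; elim: p => [|p [a [b [a0 b0 _ E]]]] /=.
  by exists 1, 0; split => // v; rewrite mul1r mul0r addr0.
have [_ pM] : posSL2 (A p.+1) by exact: posA.
rewrite add0n; exists (a * A p.+1 0 0 + b * A p.+1 1 0), (a * A p.+1 0 1 + b * A p.+1 1 1).
split; last by move=> v; rewrite E /mact /=; ring.
- by rewrite addr_ge0 // mulr_ge0 // ltW.
- by rewrite addr_ge0 // mulr_ge0 // ltW.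
- by rewrite E /mact /=; ring.
Qed.

Lemma rowsumS p : 2 * rowsum p <= rowsum p.+1.
Proof.
have [a [b [a0 b0 <- E]]] := freq_fst p.
rewrite /rowsum /= add0n E /mact /=.
have [_ pM] : posSL2 (A p.+1) by exact: posA.
have := pM 0 0; have := pM 0 1; have := pM 1 0; have := pM 1 1.
move: (A p.+1 0 0) (A p.+1 0 1) (A p.+1 1 0) (A p.+1 1 1) => x y z t *.
nia.
Qed.

Lemma rowsum_ge1 p : 1 <= rowsum p.
Proof.
elim: p => [|p IH]; first by rewrite /rowsum.
have := rowsumS p; move: (rowsum p) (rowsum p.+1) IH => x y; lia.
Qed.

Lemma sum_rowsum_le p : \sum_(1 <= i < p.+1) rowsum i <= 2 * rowsum p.
Proof.
elim: p => [|p IH]; first by rewrite big_geq //; have := rowsum_ge1 0; lia.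
rewrite big_nat_recr //=; apply: (le_trans (lerD IH (lexx _))).
have := rowsumS p; move: (rowsum p) (rowsum p.+1) => x y; lia.
Qed.

Lemma freq_fst_le p v : `|(freq A 0 p v).1| <= rowsum p * nrm1 v.
Proof.
have [a [b [a0 b0 <- ->]]] := freq_fst p; rewrite /nrm1.
apply: (le_trans (ler_normD _ _)); rewrite !normrM (ger0_norm a0) (ger0_norm b0).
have := normr_ge0 v.1; have := normr_ge0 v.2; nia.
Qed.

Lemma freq_fst_ge p v (c : int) : 0 <= c -> cone c v -> rowsum p * c <= `|(freq A 0 p v).1|.
Proof.
move=> c0; have [a [b [a0 b0 <- ->]]] := freq_fst p.
case/orP => /andP[h1 h2].
  apply: le_trans (ler_norm _); nia.
rewrite -normrN; apply: le_trans (ler_norm _); nia.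
Qed.

(** After [r.+1] steps the vector is in the cone, and each of the following [e]
    steps doubles its coordinates. *)
Lemma freq_fst_growth p r e v : v != 0 -> nrm1 v < 2 ^+ r ->
  rowsum p * 2 ^+ e <= `|(freq A 0 (p + (e + r.+1)) v).1|.
Proof.
move=> v0 vr; rewrite freq_cat add0n freq_cat.
apply: freq_fst_ge; first exact: exprn_ge0.
rewrite -[2 ^+ e]mulr1; apply: freq_cone => //.
exact: freq_enters_cone.
Qed.

(** [freq A i (e + r.+1) v] has coordinates of a common sign and of size at least
    [2 ^ e], more than [u] can compensate. *)
Lemma freq_add_neq0 i r e u v : v != 0 -> nrm1 v < 2 ^+ r -> nrm1 u < 2 ^+ e ->
  (freq A 0 (i + (e + r.+1)) v + freq A 0 i u).1 != 0.
Proof.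
move=> v0 vr ue; rewrite freq_cat add0n freq_cat -freqD.
have c1 : cone (2 ^+ e) (freq A i e (freq A (i + e) r.+1 v)).
  rewrite -[2 ^+ e]mulr1; apply: freq_cone => //; exact: freq_enters_cone.
rewrite -normr_gt0; apply: (@lt_le_trans _ _ (rowsum i * 1)).
  by have := rowsum_ge1 i; lia.
apply: freq_fst_ge => //; move: ue c1; rewrite /nrm1 /cone /=; lia.
Qed.

Lemma nrm1_freq_le (b : nat) p d v :
  (forall k i j, (1 <= k)%N -> 2 * A k i j <= 2 ^+ b) ->
  nrm1 (freq A p d v) <= 2 ^+ (b * d) * nrm1 v.
Proof.
move=> hb; elim: d v => [|d IH] v; first by rewrite muln0 expr0 mul1r.
apply: (le_trans (IH _)); rewrite mulnS exprD (mulrC (2 ^+ b)) -mulrA.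
apply: ler_wpM2l; first exact: exprn_ge0.
have k1 : (1 <= p + d.+1)%N by rewrite addnS.
have [_ pM] := posA k1.
have := hb _ 0 0 k1; have := hb _ 0 1 k1; have := hb _ 1 0 k1; have := hb _ 1 1 k1.
have := pM 0 0; have := pM 0 1; have := pM 1 0; have := pM 1 1.
rewrite /nrm1 /mact /=.
move: (A _ 0 0) (A _ 0 1) (A _ 1 0) (A _ 1 1) (2 ^+ b) v.1 v.2 => a1 a2 a3 a4 c x y g4 g3 g2 g1 *.
apply: (@le_trans _ _ ((a1 * `|x| + a2 * `|y|) + (a3 * `|x| + a4 * `|y|))).
  by apply: lerD; apply: (le_trans (ler_normD _ _));
    rewrite !normrM ?(gtr0_norm g1) ?(gtr0_norm g2) ?(gtr0_norm g3) ?(gtr0_norm g4).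
have := normr_ge0 x; have := normr_ge0 y; nia.
Qed.

End growth.
End positive_products.

(** * Translations and means on the torus *)

Lemma lebesgue_measure_translation (R : realType) (h : R) (A : set R) :
  measurable A ->
  lebesgue_measure ((fun x : R => x + h) @^-1` A) = lebesgue_measure A.
Proof.
move=> mA; pose phi (x : measurableTypeR R) : measurableTypeR R := x + h.
have mphi : measurable_fun [set: measurableTypeR R] phi.
  exact: measurable_funD.
pose phim := isMeasurableFun.Build _ _ _ _ phi mphi.
pose phi' : {mfun measurableTypeR R >-> measurableTypeR R} := HB.pack phi phim.
apply/esym; apply: (@lebesgue_measure_unique R (pushforward lebesgue_measure phi')) => //.
move=> _ [[a b] _ <-] /=; rewrite /pushforward /= lebesgue_measure_itv.
rewrite (_ : phi @^-1` _ = `](a - h), (b - h)]%classic); last first.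
  by apply/seteqP; split => x; rewrite /= !in_itv /= /phi ltrBlDr lerBrDr.
rewrite lebesgue_measure_itv /= !lte_fin ltrD2r; case: ifP => // _.
by rewrite -!EFinD opprB addrA subrK.
Qed.

Lemma ge0_integral_translation (R : realType) (h a b : R) (f : R -> \bar R) :
  measurable_fun [set: R] f -> (forall x, 0 <= f x)%E ->
  (\int[lebesgue_measure]_(x in `[a, b]) f (x + h)%R =
   \int[lebesgue_measure]_(x in `[(a + h)%R, (b + h)%R]) f x)%E.
Proof.
move=> mf f0; pose phi (x : measurableTypeR R) : measurableTypeR R := x + h.
have mphi : measurable_fun [set: measurableTypeR R] phi.
  exact: measurable_funD.
have preim : phi @^-1` `[(a + h)%R, (b + h)%R] = `[a, b]%classic.
  by apply/seteqP; split => x; rewrite /= !in_itv /= /phi !lerD2r.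
rewrite -preim -[LHS](@ge0_integral_pushforward _ _ _ _ R phi mphi) //; last first.
  exact: measurable_funTS.
apply: eq_measure_integral => A mA _.
exact: lebesgue_measure_translation.
Qed.

(** After reducing [h] modulo [1], the part of [`[h, 1 + h]] beyond [1] is carried
    back to [`[0, h]] by the period. *)
Lemma integral_uniform_periodic (R : realType) (h : R) (f : R -> \bar R) :
  measurable_fun [set: R] f -> (forall x, 0 <= f x)%E ->
  (forall x y, x - y \is a Num.int -> f x = f y) ->
  (\int[uniform_prob (@ltr01 R)]_x f (x + h)%R =
   \int[uniform_prob (@ltr01 R)]_x f x)%E.
Proof.
move=> mf f0 per.
pose k := Num.floor h; pose e := h - k%:~R.
have e0 : 0 <= e by rewrite subr_ge0 ge_floor.
have e1 : e < 1 by rewrite /e; have := floorD1_gt h; rewrite intrD -/k; lra.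
have fe x : f (x + h) = f (x + e).
  apply: per; rewrite /e (_ : _ - _ = k%:~R); first exact: intr_int.
  ring.
under eq_integral do rewrite fe.
have mfe (y : R) : measurable_fun [set: R] (fun x : R => f (x + y)).
  by apply: measurableT_comp => //; exact: measurable_funD.
rewrite !integral_uniform //; last exact: mfe.
congr mule.
rewrite ge0_integral_translation // add0r.
have -> : `[e, 1 + e]%classic = `[e, 1[ `|` `[1, 1 + e] :> set R.
  by rewrite (@itv_bndbnd_setU _ _ (BLeft e) (BLeft 1)) // bnd_simp; lra.
have -> : `[0, 1]%classic = `[0, e[ `|` `[e, 1] :> set R.
  by rewrite (@itv_bndbnd_setU _ _ (BLeft 0) (BLeft e)) // bnd_simp; lra.
have disj (a b c : R) : [disjoint `[a, b[%classic & `[b, c]%classic].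
  by apply/disj_setPRL => x /=; rewrite !in_itv /= => /andP[bx _] /andP[_]; rewrite ltNge bx.
rewrite !ge0_integral_setU //; try exact: measurable_funTS.
rewrite addeC; congr adde.
  rewrite [X in integral _ X _ = _](_ : _ = `[0 + 1, e + 1]%classic); last first.
    by rewrite add0r addrC.
  rewrite -ge0_integral_translation //.
  transitivity (\int[@lebesgue_measure R]_(x in `[0%R, e]) f x)%E.
    by apply: eq_integral => x _; apply: per; rewrite addrAC subrr add0r.
  by rewrite integral_itv_bndo_bndc //; exact: measurable_funTS.
by rewrite integral_itv_bndo_bndc //; exact: measurable_funTS.
Qed.

Section bounded_random_variables.
Context {d} {T : measurableType d} {R : realType} (P : probability T R).
Implicit Types f g : T -> R.

Definition mean f : R := \int[P]_t f t.

Definition bmeas f := measurable_fun [set: T] f /\ exists M, forall t, `|f t| <= M.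

Lemma bmeas_integrable f : bmeas f -> P.-integrable [set: T] (EFin \o f).
Proof.
move=> [mf [M fM]]; apply: measurable_bounded_integrable => //.
  by rewrite (le_lt_trans (probability_le1 P measurableT)) ?ltry.
by exists M; split; [exact: num_real | move=> x Mx t _ /=; apply: le_trans (fM t) (ltW Mx)].
Qed.

Lemma bmeas_cst (c : R) : bmeas (fun=> c).
Proof. by split; [exact: measurable_cst | exists `|c|]. Qed.

Lemma bmeasD f g : bmeas f -> bmeas g -> bmeas (fun t => f t + g t).
Proof.
move=> [mf [M fM]] [mg [N gN]]; split; first exact: measurable_funD.
by exists (M + N) => t; apply: le_trans (ler_normD _ _) _; apply: lerD.
Qed.

Lemma bmeasM f g : bmeas f -> bmeas g -> bmeas (fun t => f t * g t).
Proof.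
move=> [mf [M fM]] [mg [N gN]]; split; first exact: measurable_funM.
by exists (M * N) => t; rewrite normrM; apply: ler_pM.
Qed.

Lemma bmeasZ (c : R) f : bmeas f -> bmeas (fun t => c * f t).
Proof. by move=> bf; apply: bmeasM => //; exact: bmeas_cst. Qed.

Lemma bmeasN f : bmeas f -> bmeas (fun t => - f t).
Proof.
move=> bf; rewrite (_ : (fun t => _) = fun t => -1 * f t); first exact: bmeasZ.
by apply/funext => t; rewrite mulN1r.
Qed.

Lemma bmeasB f g : bmeas f -> bmeas g -> bmeas (fun t => f t - g t).
Proof. by move=> bf bg; apply: bmeasD => //; exact: bmeasN. Qed.

Lemma bmeas_sum (I : Type) (r : seq I) (Q : pred I) (F : I -> T -> R) :
  (forall i, Q i -> bmeas (F i)) -> bmeas (fun t => \sum_(i <- r | Q i) F i t).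
Proof.
move=> bF; elim: r => [|i r IH].
  by under eq_fun do rewrite big_nil; exact: bmeas_cst.
under eq_fun do rewrite big_cons; case: (boolP (Q i)) => Qi //.
by apply: bmeasD => //; exact: bF.
Qed.

Lemma bmeas_comp (phi : R -> R) f (M : R) : continuous phi ->
  (forall x, `|phi x| <= M) -> measurable_fun [set: T] f -> bmeas (phi \o f).
Proof.
move=> cphi phiM mf; split; last by exists M => t; exact: phiM.
by apply: measurableT_comp => //; exact: continuous_measurable_fun.
Qed.

Lemma mean_cst (c : R) : mean (fun=> c) = c.
Proof. by rewrite /mean Rintegral_cst //= probability_setT /= mulr1. Qed.

Lemma meanD f g : bmeas f -> bmeas g -> mean (fun t => f t + g t) = mean f + mean g.
Proof. by move=> bf bg; rewrite /mean RintegralD //; exact: bmeas_integrable. Qed.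

Lemma meanZ (c : R) f : bmeas f -> mean (fun t => c * f t) = c * mean f.
Proof. by move=> bf; rewrite /mean RintegralZl //; exact: bmeas_integrable. Qed.

Lemma meanB f g : bmeas f -> bmeas g -> mean (fun t => f t - g t) = mean f - mean g.
Proof. by move=> bf bg; rewrite /mean RintegralB //; exact: bmeas_integrable. Qed.

Lemma meanN f : bmeas f -> mean (fun t => - f t) = - mean f.
Proof.
move=> bf; rewrite -[RHS]mulN1r -meanZ //; congr mean.
by apply/funext => t; rewrite mulN1r.
Qed.

Lemma mean_sum (I : Type) (r : seq I) (Q : pred I) (F : I -> T -> R) :
  (forall i, Q i -> bmeas (F i)) ->
  mean (fun t => \sum_(i <- r | Q i) F i t) = \sum_(i <- r | Q i) mean (F i).
Proof.
move=> bF; elim: r => [|i r IH].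
  by under eq_fun do rewrite big_nil; rewrite mean_cst big_nil.
rewrite big_cons -IH; under eq_fun do rewrite big_cons.
case: (boolP (Q i)) => Qi //; rewrite meanD //; [exact: bF | exact: bmeas_sum].
Qed.

Lemma le_mean f g : bmeas f -> bmeas g -> (forall t, f t <= g t) -> mean f <= mean g.
Proof. by move=> bf bg fg; apply: le_Rintegral => //; exact: bmeas_integrable. Qed.

Lemma normr_mean_le f (M : R) : measurable_fun [set: T] f -> (forall t, `|f t| <= M) ->
  `|mean f| <= M.
Proof.
move=> mf fM; have bf : bmeas f by split => //; exists M.
rewrite ler_norml; apply/andP; split.
  rewrite -(mean_cst (- M)); apply: le_mean => //; first exact: bmeas_cst.
  by move=> t; have := fM t; rewrite ler_norml => /andP[].
rewrite -[leRHS]mean_cst; apply: le_mean => //; first exact: bmeas_cst.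
by move=> t; have := fM t; rewrite ler_norml => /andP[].
Qed.

End bounded_random_variables.
Arguments mean {d T R} P f.

Section decorrelation.
Context {disp} {T : measurableType disp} {R : realType} (P : probability T R).
Implicit Types F H : T -> R.

(** An approximate form of the factorization that independence would give. For a
    fixed [F] it passes to linear combinations of the [H], which is why it can be
    checked wave by wave. *)
Definition decorr F H (d : R) : Prop :=
  `|mean P (fun t => F t * H t) - mean P F * mean P H| <= d.

Lemma decorr_sum (I : Type) (s : seq I) (Q : pred I) (c : I -> R)
    (H : I -> T -> R) F (d : R) :
  bmeas F -> (forall i, Q i -> bmeas (H i)) -> (forall i, Q i -> decorr F (H i) d) ->
  decorr F (fun t => \sum_(i <- s | Q i) c i * H i t) ((\sum_(i <- s | Q i) `|c i|) * d).
Proof.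
move=> bF bH dH; rewrite /decorr.
rewrite [X in mean _ X - _](_ : _ = fun t => \sum_(i <- s | Q i) c i * (F t * H i t)); last first.
  apply/funext => t; rewrite mulr_sumr; apply: eq_bigr => i _; ring.
have bFH i : Q i -> bmeas (fun t => F t * H i t) by move=> Qi; apply: bmeasM => //; exact: bH.
rewrite !mean_sum; try by move=> i Qi; apply: bmeasZ; (exact: bH || exact: bFH).
rewrite mulr_sumr -sumrB mulr_suml; apply: le_trans (ler_norm_sum _ _ _) _.
apply: ler_sum => i Qi; rewrite !meanZ; [|exact: bH|exact: bFH].
by rewrite mulrCA -mulrBr normrM ler_wpM2l //; exact: dH.
Qed.

Lemma decorrD F H H' (d : R) : bmeas F -> bmeas H -> bmeas H' ->
  decorr F H d -> decorr F H' d ->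
  decorr F (fun t => 2^-1 * (H t + H' t)) d.
Proof.
move=> bF bH bH' dH dH'; rewrite /decorr.
rewrite [X in mean _ X - _](_ : _ = fun t => 2^-1 * (F t * H t + F t * H' t)); last first.
  by apply/funext => t; ring.
have b1 := bmeasM bF bH; have b2 := bmeasM bF bH'.
rewrite meanZ; last exact: (bmeasD b1 b2).
rewrite meanZ; last exact: (bmeasD bH bH').
rewrite (meanD _ b1 b2) (meanD _ bH bH').
move: dH dH'; rewrite /decorr !ler_norml; set a := mean _ _; set b := mean _ F.
set p := mean _ H; set q := mean _ _; set q' := mean _ H' => /andP[h1 h2] /andP[h3 h4].
rewrite (_ : _ - _ = 2^-1 * ((a - b * p) + (q - b * q'))); last by ring.
by apply/andP; split; lra.
Qed.

End decorrelation.
Arguments decorr {disp T R} P F H d.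

Section torus_shift.
Context {R : realType}.
Implicit Types (t : torus R) (F : torus R -> R).

Definition tshift (u : R * R) t : torus R :=
  to_torus ((repr t).1 + u.1, (repr t).2 + u.2).

Lemma tshiftE u (x : R * R) :
  tshift u (to_torus x) = to_torus (x.1 + u.1, x.2 + u.2).
Proof.
apply/to_torusP; have /andP[/= H1 H2] := congZ2_repr x.
by apply/andP; split => //=; rewrite opprD addrACA subrr addr0.
Qed.

Local Notation plane := (measurableTypeR R * measurableTypeR R)%type.

Lemma measurable_tshift u : measurable_fun [set: torus R] (tshift u).
Proof.
apply: measurable_fun_torus.
have -> : tshift u \o @to_torus R =
    @to_torus R \o (fun x : plane => (x.1 + u.1, x.2 + u.2)).
  by apply/funext => x; exact: tshiftE.
apply: (@measurableT_comp _ _ _ _ plane); first exact: measurable_to_torus.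
by apply: measurable_fun_pair => //; exact: measurable_funD.
Qed.

(** By Tonelli it is enough to translate one coordinate at a time. *)
Lemma ge0_integral_tshift u (f : torus R -> \bar R) :
  measurable_fun [set: torus R] f -> (forall t, 0 <= f t)%E ->
  (\int[@lebesgue_torus R]_t f (tshift u t) = \int[@lebesgue_torus R]_t f t)%E.
Proof.
move=> mf f0.
pose f2 t := f (tshift (0, u.2) t).
have ms v : measurable_fun [set: torus R] (f \o tshift v).
  by apply: measurableT_comp => //; exact: measurable_tshift.
have mG (g : torus R -> \bar R) : measurable_fun [set: torus R] g ->
    measurable_fun [set: plane] (g \o @to_torus R).
  by move=> mg; apply: measurableT_comp => //; exact: measurable_to_torus.
have cong x x' y y' : x - x' \is a Num.int -> y - y' \is a Num.int ->
    to_torus (x, y) = to_torus (x', y') :> torus R.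
  by move=> hx hy; apply/to_torusP; apply/andP.
transitivity (\int[@lebesgue_torus R]_t f2 t)%E.
  rewrite !ge0_integral_distribution //; try exact: (ms u); try exact: (ms (0, u.2));
  try by move=> x; exact: f0.
  rewrite !fubini_tonelli2;
    try exact: (mG _ (ms u)); try exact: (mG _ (ms (0, u.2))); try by move=> x; exact: f0.
  apply: eq_integral => y _; rewrite /fubini_G /f2 /=.
  under eq_integral do rewrite tshiftE /=.
  under [in RHS]eq_integral do rewrite tshiftE /= addr0.
  apply: (@integral_uniform_periodic R u.1
      (fun x => f (to_torus (x, y + u.2)))) => //.
    by apply: (measurableT_comp (mG _ mf)); exact: measurable_pair2.
  by move=> x x' xx'; congr f; apply: cong => //; rewrite subrr.
rewrite !ge0_integral_distribution //; try exact: (ms u); try exact: (ms (0, u.2));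
  try by move=> x; exact: f0.
rewrite !fubini_tonelli1;
  try exact: (mG _ mf); try exact: (mG _ (ms (0, u.2))); try by move=> x; exact: f0.
apply: eq_integral => x _; rewrite /fubini_F /f2 /=.
under eq_integral do rewrite tshiftE /= addr0.
apply: (@integral_uniform_periodic R u.2 (fun y => f (to_torus (x, y)))) => //.
  by apply: (measurableT_comp (mG _ mf)); exact: measurable_pair1.
by move=> y y' yy'; congr f; apply: cong => //; rewrite subrr.
Qed.

Lemma bmeas_tshift u F : bmeas F -> bmeas (F \o tshift u).
Proof.
move=> [mF [M FM]]; split; last by exists M => t; exact: FM.
by apply: measurableT_comp => //; exact: measurable_tshift.
Qed.

Lemma mean_tshift u F : bmeas F ->
  mean (@lebesgue_torus R) (F \o tshift u) = mean (@lebesgue_torus R) F.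
Proof.
move=> bF; have [mF [M FM]] := bF; have bFs := bmeas_tshift u bF.
have bM := @bmeas_cst _ (torus R) R M.
(* The invariance is known for nonnegative functions, hence the constant. *)
have E (G : torus R -> R) : bmeas G -> mean (@lebesgue_torus R) G =
    mean (@lebesgue_torus R) (fun t => G t + M) - M.
  by move=> bG; rewrite meanD // mean_cst addrK.
rewrite E // [RHS]E //; congr (_ - _); congr fine.
apply: (@ge0_integral_tshift u (fun t => (F t + M)%:E)).
  by apply/measurable_EFinP; apply: measurable_funD.
by move=> t; rewrite lee_fin; have := FM t; rewrite ler_norml; lra.
Qed.

(** The phase shift [th] makes cosines and sines instances of the same function,
    and is harmless in all the estimates. *)
Definition wave (f : int * int) (th : R) t : R := cos (phase f (repr t) + th).

Lemma wave_to_torus f th (x : R * R) : wave f th (to_torus x) = cos (phase f x + th).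
Proof. by rewrite /wave !cosD cos_phase sin_phase. Qed.

Lemma measurable_wave f th : measurable_fun [set: torus R] (wave f th).
Proof.
apply: measurable_fun_torus.
have -> : wave f th \o @to_torus R = fun x : plane => cos (phase f x + th).
  by apply/funext => x; exact: wave_to_torus.
apply: (@measurableT_comp _ _ _ _ _ _ cos).
  by apply: continuous_measurable_fun; exact: continuous_cos.
apply: measurable_funD => //; apply: measurable_funM => //.
exact: measurable_linear_form.
Qed.

Lemma wave_bound f th t : `|wave f th t| <= 1.
Proof. exact: cos_max. Qed.

Lemma bmeas_wave f th : bmeas (wave f th).
Proof. by split; [exact: measurable_wave | exists 1; exact: wave_bound]. Qed.

Lemma wave_tshift f th u t :
  wave f th (tshift u t) = cos (phase f (repr t) + th + phase f u).
Proof. by rewrite wave_to_torus /phase /=; congr cos; ring. Qed.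

Lemma wave_half_shift f th u t : phase f u = pi ->
  wave f th (tshift u t) = - wave f th t.
Proof. by move=> fu; rewrite wave_tshift fu; exact: cosDpi. Qed.

(** Only horizontal translations are needed for the regularity of the observables:
    one coordinate of a frequency measures how fast the wave oscillates. *)
Definition xlip (K : R) F := forall h t, `|F (tshift (h, 0) t) - F t| <= K * `|h|.

Lemma mean_wave0 f th : f != 0 -> mean (@lebesgue_torus R) (wave f th) = 0.
Proof.
move=> f0.
have [u fu] : exists u : R * R, phase f u = pi.
  have [f1|f1] := eqVneq f.1 0; last first.
    exists ((2 * f.1%:~R)^-1, 0); rewrite /phase /= mulr0 addr0; field.
    by rewrite intr_eq0.
  have f2 : f.2 != 0.
    by apply: contra_neq f0 => f2; case: f f1 f2 => a b /= -> ->.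
  exists (0, (2 * f.2%:~R)^-1); rewrite /phase /= mulr0 add0r; field.
  by rewrite intr_eq0.
have bW := bmeas_wave f th.
have : mean (@lebesgue_torus R) (wave f th) = - mean (@lebesgue_torus R) (wave f th).
  rewrite -meanN // -[LHS](mean_tshift u) //; congr mean.
  by apply/funext => t /=; rewrite wave_half_shift.
lra.
Qed.

(** Translating by half a wavelength changes the sign of the wave and hardly
    changes [F]; averaging the two gives the bound. *)
Lemma mean_wave_le F K f th : bmeas F -> xlip K F -> f.1 != 0 ->
  `|mean (@lebesgue_torus R) (fun t => F t * wave f th t)| <= K / `|f.1%:~R|.
Proof.
move=> bF lF f1; set mu := @lebesgue_torus R; set I := mean _ _.
have f1R : f.1%:~R != 0 :> R by rewrite intr_eq0.
pose h : R := (2 * f.1%:~R)^-1; pose u : R * R := (h, 0).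
have fu : phase f u = pi by rewrite /phase /u /h /= mulr0 addr0; field.
have bW := bmeas_wave f th; have bFs := bmeas_tshift u bF.
have E1 : I = - mean mu (fun t => (F \o tshift u) t * wave f th t).
  rewrite -meanN; last exact: bmeasM.
  rewrite /I -(mean_tshift u); last exact: bmeasM.
  by congr mean; apply/funext => t /=; rewrite wave_half_shift // mulrN.
have E2 : 2 * I = mean mu (fun t => (F t - (F \o tshift u) t) * wave f th t).
  rewrite mulr_natl mulr2n {2}E1 -meanB; [|exact: bmeasM..].
  by congr mean; apply/funext => t; rewrite mulrBl.
have : `|2 * I| <= K * `|h|.
  rewrite E2; apply: normr_mean_le.
    by apply: measurable_funM; [exact: (bmeasB bF bFs).1 | exact: bW.1].
  move=> t; rewrite normrM -[leRHS]mulr1; apply: ler_pM => //.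
    by rewrite distrC; exact: lF.
  exact: wave_bound.
have K0 : 0 <= K.
  by have := le_trans (normr_ge0 _) (lF 1 point); rewrite normr1 mulr1.
have : 0 <= K / `|f.1%:~R| by rewrite divr_ge0.
have -> : `|h| = 2^-1 * `|f.1%:~R|^-1 by rewrite /h normfV normrM invfM (@ger0_norm _ 2).
rewrite normrM (@ger0_norm _ 2) //; lra.
Qed.

End torus_shift.

(** * Mixing for lacunary sums of waves *)

Section wave_sums.
Context {R : realType}.
Local Notation mu := (@lebesgue_torus R).
Implicit Types (t : torus R) (F H : torus R -> R) (f : int * int).

Lemma cos_lip (x y : R) : `|cos y - cos x| <= `|y - x|.
Proof.
rewrite -[leRHS]mul1r; apply: (@mvt_boundT R cos (fun x => - sin x)).
by move=> z; rewrite normrN; exact: sin_max.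
Qed.

Lemma xlip_wave f th : xlip (8 * `|f.1|%:~R) (@wave R f th).
Proof.
move=> h t; rewrite wave_tshift /wave; apply: le_trans (cos_lip _ _) _.
rewrite addrAC subrr add0r /phase /= mulr0 addr0.
rewrite !normrM (@ger0_norm _ 2) // (ger0_norm (@pi_ge0 R)) intr_norm mulrA.
rewrite ler_wpM2r // ler_wpM2r //; have := @pihalf_lt2 R; lra.
Qed.

Lemma xlip_ge0 K F : xlip K F -> 0 <= K.
Proof. by move=> /(_ 1 point) /(le_trans (normr_ge0 _)); rewrite normr1 mulr1. Qed.

Lemma le_xlip K K' F : K <= K' -> xlip K F -> xlip K' F.
Proof. by move=> KK lF h t; apply: le_trans (lF h t) _; rewrite ler_wpM2r. Qed.

Lemma xlip_sum (I : Type) (s : seq I) (Q : pred I) (K : I -> R) (F : I -> torus R -> R) :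
  (forall i, Q i -> xlip (K i) (F i)) ->
  xlip (\sum_(i <- s | Q i) K i) (fun t => \sum_(i <- s | Q i) F i t).
Proof.
move=> lF h t; rewrite -sumrB mulr_suml; apply: le_trans (ler_norm_sum _ _ _) _.
by apply: ler_sum => i Qi; exact: lF.
Qed.

Lemma xlipZ K F (c : R) : xlip K F -> xlip (`|c| * K) (fun t => c * F t).
Proof. by move=> lF h t; rewrite -mulrBr normrM -mulrA ler_wpM2l. Qed.

Lemma xlip_comp K L F (phi : R -> R) : 0 <= L ->
  (forall x y, `|phi x - phi y| <= L * `|x - y|) ->
  xlip K F -> xlip (L * K) (phi \o F).
Proof.
move=> L0 lphi lF h t; apply: le_trans (lphi _ _) _.
by rewrite -mulrA ler_wpM2l.
Qed.

Lemma wave_mul f f' th th' t : wave f th t * wave f' th' t =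
  2^-1 * (wave (f + f') (th + th') t + wave (f - f') (th - th') t) :> R.
Proof.
rewrite /wave; set a := phase f _ + th; set b := phase f' _ + th'.
rewrite (_ : phase _ _ + (th + th') = a + b); last first.
  by rewrite /a /b /phase /= !intrD; ring.
rewrite (_ : phase _ _ + (th - th') = a - b); last first.
  by rewrite /a /b /phase /= !intrD !mulrNz; ring.
by rewrite cosD cosB; field.
Qed.

Lemma decorr_wave F K f th (c : R) : bmeas F -> xlip K F -> 0 < c ->
  f != 0 -> c <= `|f.1|%:~R -> decorr mu F (@wave R f th) (K / c).
Proof.
move=> bF lF c0 f0 cf; rewrite /decorr mean_wave0 // mulr0 subr0.
have f1 : 0 < `|f.1|%:~R :> R := lt_le_trans c0 cf.
apply: le_trans (mean_wave_le (K := K) _ _ _ _) _ => //.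
  by rewrite -normr_gt0 -(ltr_int R).
rewrite -intr_norm ler_wpM2l ?lef_pV2 ?posrE //; exact: xlip_ge0 lF.
Qed.

Lemma decorr_wave0 F K th (c : R) : bmeas F -> xlip K F -> 0 < c ->
  decorr mu F (@wave R 0 th) (K / c).
Proof.
move=> bF lF c0; have -> : @wave R 0 th = fun=> cos th.
  by apply/funext => t; rewrite /wave /phase /= !mul0r addr0 mulr0 add0r.
rewrite /decorr mean_cst; under eq_fun do rewrite mulrC.
rewrite meanZ // mulrC subrr normr0; apply: divr_ge0; last exact: ltW.
exact: xlip_ge0 lF.
Qed.

(** A triple [(c, m, th)] stands for [c * cos (2 pi <m, x> + th)]; composing with
    [tau_k ... tau_1] only changes the frequency. *)
Definition wsum (l : seq (R * (int * int) * R)) (A : nat -> 'M[int]_2) k t : R :=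
  \sum_(z <- l) z.1.1 * wave (freq A 0 k z.1.2) z.2 t.

Lemma wave_toral_prod A f th k t :
  wave f th (toral_prod A k t) = wave (freq A 0 k f) th t :> R.
Proof.
elim: k f => [//|k IH] f /=; rewrite -IH add0n.
rewrite /toral_aut wave_to_torus; congr cos; congr (_ + _).
by rewrite /phase /int_lin /mact /= !mxE !intrD !intrM; ring.
Qed.

Lemma trigpoly_wsum (g : trigpoly R) :
  exists l, forall A k t, g (toral_prod A k t) = wsum l A k t.
Proof.
exists ([seq (cos_coef g m, m, 0) | m <- freqs g]
     ++ [seq (sin_coef g m, m, - (pi / 2)) | m <- freqs g]) => A k t.
rewrite /wsum big_cat /= !big_map -big_split /=; apply: eq_bigr => m _.
by rewrite -!wave_toral_prod /wave addr0 cosBpihalf.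
Qed.

Lemma bmeas_wsum l A k : bmeas (wsum l A k).
Proof. by apply: bmeas_sum => z _; apply: bmeasZ; exact: bmeas_wave. Qed.

(** Waves of nonzero frequency have mean zero, so that the constant terms add up to
    the mean of the polynomial. *)
Lemma trigpoly_wsum0 (g : trigpoly R) : (\int[mu]_t (g t)%:E = 0)%E ->
  exists l, {in l, forall z, z.1.2 != 0} /\
    forall A k t, g (toral_prod A k t) = wsum l A k t.
Proof.
move=> g0; have [l E] := trigpoly_wsum g.
exists [seq z <- l | z.1.2 != 0]; split=> [z|A k t].
  by rewrite mem_filter => /andP[].
rewrite E /wsum big_filter (bigID (fun z => z.1.2 == 0)) /=.
rewrite (_ : \sum_(z <- l | z.1.2 == 0) _ = \sum_(z <- l | z.1.2 == 0) z.1.1 * cos z.2).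
  suff -> : \sum_(z <- l | z.1.2 == 0) z.1.1 * cos z.2 = 0 by rewrite add0r.
  have : mean mu g = 0 by rewrite /mean /Rintegral g0.
  have -> : g = wsum l (fun=> 0) 0 :> (torus R -> R).
    by apply/funext => s; rewrite -E.
  rewrite /wsum mean_sum; last by move=> z _; apply: bmeasZ; exact: bmeas_wave.
  rewrite (bigID (fun z => z.1.2 == 0)) /= [X in _ + X]big1 => [|z z0]; last first.
    by rewrite meanZ ?mean_wave0 ?mulr0 //; exact: bmeas_wave.
  rewrite addr0 => h; rewrite -[RHS]h; apply: eq_bigr => z /eqP ->.
  rewrite meanZ; last exact: bmeas_wave.
  congr (_ * _); rewrite -[LHS](mean_cst mu); congr mean.
  by apply/funext => s; rewrite /wave /phase /= !mul0r addr0 mulr0 add0r.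
apply: eq_bigr => z /eqP ->; congr (_ * _).
by rewrite freq0 /wave /phase /= !mul0r addr0 mulr0 add0r.
Qed.

Section lacunary.
Variables (A : nat -> 'M[int]_2) (posA : forall k, (1 <= k)%N -> posSL2 (A k)).
Variables (l : seq (R * (int * int) * R)) (r : nat).
Hypothesis l0 : {in l, forall z, z.1.2 != 0}.
Hypothesis lr : {in l, forall z, nrm1 z.1.2 < 2 ^+ r}.

Local Notation W := (wsum l A).
Local Notation q := (rowsum A).

Definition amplitude : R := \sum_(z <- l) `|z.1.1|.
Local Notation G := amplitude.

Lemma amplitude_ge0 : 0 <= G.
Proof. exact: sumr_ge0. Qed.

Lemma wsum_bound k t : `|W k t| <= G.
Proof.
apply: le_trans (ler_norm_sum _ _ _) _; apply: ler_sum => z _.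
by rewrite normrM -[leRHS]mulr1 ler_wpM2l //; exact: wave_bound.
Qed.

Lemma rowsumR_gt0 p : 0 < (q p)%:~R :> R.
Proof. by rewrite ltr0z; apply: lt_le_trans (rowsum_ge1 posA p). Qed.

Lemma xlip_wsum k : xlip (8 * 2 ^+ r * G * (q k)%:~R) (W k).
Proof.
rewrite [X in xlip X](_ : _ = \sum_(z <- l) `|z.1.1| * (8 * (q k * 2 ^+ r)%:~R)); last first.
  by rewrite -mulr_suml intrM rmorphXn /= /amplitude; ring.
rewrite /wsum => h t; rewrite big_seq [X in _ - X]big_seq [X in X * _]big_seq.
move: h t; apply: xlip_sum => z zl; apply: xlipZ.
apply: le_xlip (xlip_wave _ _); rewrite ler_wpM2l // ler_int.
apply: le_trans (freq_fst_le posA _ _) _; rewrite ler_wpM2l ?ltW ?lr //.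
exact: lt_le_trans (rowsum_ge1 posA k).
Qed.

(** The Lipschitz constants of the terms grow geometrically, so that the last one
    dominates the whole sum. *)
Lemma xlip_sum_wsum p :
  xlip (16 * 2 ^+ r * G * (q p)%:~R) (fun t => \sum_(1 <= i < p.+1) W i t).
Proof.
apply: le_xlip (@xlip_sum nat (index_iota 1 p.+1) xpredT
  (fun i => 8 * 2 ^+ r * G * (q i)%:~R) (fun i => W i) (fun i _ => xlip_wsum i)).
rewrite -mulr_sumr.
have -> : \sum_(1 <= i < p.+1) (q i)%:~R = (\sum_(1 <= i < p.+1) q i)%:~R :> R.
  by rewrite rmorph_sum.
rewrite (_ : 16 * _ * _ * _ = 8 * 2 ^+ r * G * (2 * q p)%:~R); last by rewrite intrM; ring.
rewrite ler_wpM2l ?ler_int ?sum_rowsum_le //.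
by rewrite !mulr_ge0 ?exprn_ge0 //; exact: amplitude_ge0.
Qed.

(** The Lipschitz constant of a function of the past up to [p] is of the order of
    [rowsum A p], while the frequencies at [e + r.+1] steps later are larger by a
    factor [2 ^ e]. *)
Lemma mean_mul_wsum_le F K p e : bmeas F -> xlip K F ->
  `|mean mu (fun t => F t * W (p + (e + r.+1)) t)| <= G * (K / ((q p)%:~R * 2 ^+ e)).
Proof.
move=> bF lF; set k := (p + _)%N.
have mX : mean mu (W k) = 0.
  rewrite /wsum mean_sum; last by move=> z _; apply: bmeasZ; exact: bmeas_wave.
  rewrite big_seq big1 // => z zl; rewrite meanZ; last exact: bmeas_wave.
  by rewrite mean_wave0 ?mulr0 //; apply: freq_neq0 => //; exact: l0.
suff : decorr mu F (W k) (G * (K / ((q p)%:~R * 2 ^+ e))) by rewrite /decorr mX mulr0 subr0.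
have -> : W k = fun t => \sum_(z <- l | z \in l) z.1.1 * wave (freq A 0 k z.1.2) z.2 t.
  by apply/funext => t; rewrite /wsum big_seq.
rewrite /amplitude [X in X * _]big_seq.
apply: decorr_sum => // z zl; first exact: bmeas_wave.
apply: decorr_wave => //.
- by rewrite mulr_gt0 ?exprn_gt0 // rowsumR_gt0.
- by apply: freq_neq0 => //; exact: l0.
have := freq_fst_growth posA p e (l0 zl) (lr zl).
by rewrite -(ler_int R) intrM rmorphXn /=.
Qed.

(** The product is a combination of waves whose frequencies are sums of one
    frequency of each term; terms that far apart have frequencies of such different
    sizes that no sum vanishes. *)
Lemma mean_wsum_mul0 i e : (r <= e)%N ->
  mean mu (fun t => W (i + (e + r.+1)) t * W i t) = 0.
Proof.
move=> re; set k := (i + _)%N.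
under eq_fun do rewrite /wsum mulr_suml big_seq.
rewrite mean_sum => [|z _]; last first.
  by apply: bmeasM; [apply: bmeasZ; exact: bmeas_wave | exact: bmeas_wsum].
apply: big1 => z zl.
under eq_fun do rewrite mulr_sumr big_seq.
rewrite mean_sum => [|z' _]; last first.
  by apply: bmeasM; apply: bmeasZ; exact: bmeas_wave.
apply: big1 => z' zl'.
under eq_fun do rewrite mulrACA wave_mul.
rewrite meanZ; last by apply: bmeasZ; apply: bmeasD; exact: bmeas_wave.
rewrite meanZ; last by apply: bmeasD; exact: bmeas_wave.
have r2 u : nrm1 u < 2 ^+ r -> nrm1 u < 2 ^+ e.
  by move=> /lt_le_trans; apply; rewrite ler_eXn2l.
rewrite meanD; [|exact: bmeas_wave..].
rewrite !mean_wave0 ?addr0 ?mulr0 // -?freqN pair_neq0; apply/orP; left.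
  apply: freq_add_neq0 => //; [exact: l0|exact: lr|apply: r2].
  by move: (lr zl'); rewrite /nrm1 /= !normrN.
by apply: freq_add_neq0 => //; [exact: l0|exact: lr|apply: r2; exact: lr].
Qed.

(** The frequencies of the product can be small although both factors oscillate
    fast: they are [freq A 0 i w] with [w] of length less than [2 ^ (b * d + r.+1)], and
    such a [w] may need [b * d + r.+2] steps to enter the cone. Hence the delay
    between [p] and [i] proportional to [d]. A vanishing [w] contributes a constant. *)
Lemma decorr_wsum_mul b F K p d i : (forall k i j, (1 <= k)%N -> 2 * A k i j <= 2 ^+ b) ->
  bmeas F -> xlip K F -> (p + (b * d + r.+1).+1 <= i)%N ->
  decorr mu F (fun t => W (i + d) t * W i t) (G * (G * (K / (q p)%:~R))).
Proof.
move=> hb bF lF hi; pose e := (i - (p + (b * d + r.+1).+1))%N.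
have Ei : i = (p + (e + (b * d + r.+1).+1))%N by rewrite /e; lia.
rewrite [X in decorr _ _ X](_ : _ = fun t => \sum_(z <- l | z \in l) z.1.1 *
    (\sum_(z' <- l | z' \in l) z'.1.1 *
      (wave (freq A 0 (i + d) z.1.2) z.2 t * wave (freq A 0 i z'.1.2) z'.2 t))); last first.
  apply/funext => t; rewrite /wsum mulr_suml big_seq; apply: eq_bigr => z zl.
  rewrite mulr_sumr [LHS]big_seq mulr_sumr; apply: eq_bigr => z' zl'; ring.
have bW z z' : bmeas (fun t : torus R => wave (freq A 0 (i + d) z.1.2) z.2 t *
    wave (freq A 0 i z'.1.2) z'.2 t) by apply: bmeasM; exact: bmeas_wave.
rewrite /amplitude [X in X * _]big_seq; apply: decorr_sum => // z zl.
  by apply: bmeas_sum => z' _; exact: bmeasZ.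
rewrite [X in X * _]big_seq; apply: decorr_sum => // z' zl'.
have key w th : nrm1 w < 2 ^+ (b * d + r.+1) ->
    decorr mu F (@wave R (freq A 0 i w) th) (K / (q p)%:~R).
  move=> ws; have [->|w0] := eqVneq w 0.
    by rewrite freq0; apply: decorr_wave0 => //; exact: rowsumR_gt0.
  apply: decorr_wave => //; [exact: rowsumR_gt0|exact: freq_neq0|].
  have := freq_fst_growth posA p e w0 ws; rewrite -Ei -(ler_int R); apply: le_trans.
  rewrite ler_int -[leLHS]mulr1 ler_wpM2l ?exprn_ege1 //.
  exact: le_trans (rowsum_ge1 posA p).
have short w : nrm1 w < 2 ^+ r ->
    nrm1 (freq A i d z.1.2 + w) < 2 ^+ (b * d + r.+1).
  move=> wr; have h1 := nrm1_freq_le posA i d z.1.2 hb.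
  have h2 : 2 ^+ (b * d) * nrm1 z.1.2 < 2 ^+ (b * d) * 2 ^+ r.
    by rewrite ltr_pM2l ?exprn_gt0 //; exact: lr.
  have h3 : 2 ^+ r <= 2 ^+ (b * d) * 2 ^+ r :> int.
    by rewrite ler_peMl ?exprn_ge0 // exprn_ege1.
  rewrite exprD exprS; move: h1 h2 h3 wr; rewrite /nrm1 /=.
  set x := 2 ^+ (b * d) * _; set y := 2 ^+ (b * d) * 2 ^+ r.
  rewrite (_ : 2 ^+ (b * d) * (2 * 2 ^+ r) = 2 * y); last by rewrite /y; ring.
  by move: (freq _ _ _ _) x y => [? ?] x y /=; lia.
have E : freq A 0 (i + d) z.1.2 = freq A 0 i (freq A i d z.1.2).
  by rewrite freq_cat add0n.
under eq_fun do rewrite wave_mul E -freqN -!freqD.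
apply: decorrD => //; try exact: bmeas_wave; apply: key; apply: short; first exact: lr.
by move: (lr zl'); rewrite /nrm1 /= !normrN.
Qed.

End lacunary.
End wave_sums.

(** * The one-sided replacement argument *)

(** Replacing the increment [X] by the time increment [v]. The first order term is
    evaluated at the intermediate past [U + D2], with the correction [X * D] due to
    the recent past [D]; all the second order terms are evaluated at the remote past
    [U]. By the heat equation the variance [v] enters with the same coefficient as
    [X * D + X ^ 2 / 2], so that it remains to take means. The remainder collects six
    Taylor errors with the constants 10, 10, 10, 5, 81 and 15. *)
Lemma lindeberg_pointwise (R : realType) (a U D2 D X v e beta h tau tau' : R) :
  0 < e -> 0 <= beta -> beta <= e -> 1 <= h -> e ^+ 2 <= tau -> e ^+ 2 <= tau' ->
  tau' = tau + v -> `|X| <= beta -> `|D| <= h * beta -> `|D2| <= h * beta ->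
  `|D + D2| <= h * beta -> `|v| <= 3 * h * beta ^+ 2 ->
  `|Phi ((a - (U + D2 + D + X)) / Num.sqrt tau) - Phi ((a - (U + D2 + D)) / Num.sqrt tau')
    + X / Num.sqrt tau * gd ((a - (U + D2)) / Num.sqrt tau)
    - (X * D + X ^+ 2 / 2 - v / 2) / tau * gd1 ((a - U) / Num.sqrt tau)|
  <= 131 * h ^+ 2 * (beta / e) ^+ 3.
Proof.
move=> e0 b0 be h1 et et' tauE Xb Db D2b DDb vb.
have t0 : 0 < tau by apply: lt_le_trans et; rewrite exprn_gt0.
set s := Num.sqrt tau; have s0 : 0 < s by rewrite sqrtr_gt0.
have tE : tau = s ^+ 2 by rewrite sqr_sqrtr // ltW.
have es : e <= s by rewrite -(@ler_pXn2r _ 2) // ?nnegrE ?(ltW e0) ?(ltW s0) // -tE.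
set rho := beta / e; have r0 : 0 <= rho by rewrite divr_ge0 // ltW.
have r1 : rho <= 1 by rewrite ler_pdivrMr // mul1r.
have scale y c : `|y| <= c * beta -> 0 <= c -> `|y / s| <= c * rho.
  move=> yc c0; rewrite normrM normfV (gtr0_norm s0) ler_pdivrMr //.
  apply: (le_trans yc); rewrite /rho -mulrA ler_wpM2l //.
  by rewrite -mulrA ler_peMr // mulrC ler_pdivlMr ?mul1r.
set x' := X / s; set D' := D / s; set D2' := D2 / s.
have h0 : 0 <= h by apply: le_trans h1.
have xb : `|x'| <= rho by rewrite -[rho]mul1r; apply: scale; rewrite ?mul1r.
have db : `|D'| <= h * rho by exact: scale.
have d2b : `|D2'| <= h * rho by exact: scale.
have ddb : `|D' + D2'| <= h * rho by rewrite /D' /D2' -mulrDl; exact: scale.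
set z := (a - (U + D2 + D)) / s.
have -> : (a - (U + D2 + D + X)) / s = z + - x' by rewrite /z /x'; field; exact: lt0r_neq0.
have -> : (a - (U + D2)) / s = z + D' by rewrite /z /D'; field; exact: lt0r_neq0.
have -> : (a - U) / s = z + (D' + D2') by rewrite /z /D' /D2'; field; exact: lt0r_neq0.
have A1 := Phi_taylor z (- x'); rewrite normrN sqrrN in A1.
have A2 := gd_taylor (z + D') (- D'); rewrite addrK sqrrN in A2.
have A3 := gd1_lip (z + D') D2'; rewrite -addrA in A3.
have A4 := gd1_lip z (D' + D2').
have A5 := Phi_time_taylor (a - (U + D2 + D)) (exprn_gt0 2 e0) et et'.
have tv : tau' - tau = v by rewrite tauE addrAC subrr add0r.
rewrite -/s -/z tv in A5.
set y' := z + (D' + D2') in A3 A4 *.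
set P1 := Phi (z + - x') in A1 *; set P0 := Phi z in A1 A5 *; set P2 := Phi _ in A5 *.
set g0 := gd z in A1 A2 *; set gy := gd (z + D') in A2 *.
set k0 := gd1 z in A1 A4 A5 *; set ky := gd1 (z + D') in A2 A3; set ky' := gd1 y' in A3 A4 *.
set T1 := P1 - P0 - _ - _ in A1.
set T2 := g0 - gy - _ in A2.
set T3 := ky' - ky in A3.
set T4 := ky' - k0 in A4.
set T5 := P2 - P0 - _ in A5.
have x2 : x' ^+ 2 <= rho ^+ 2 by rewrite -real_normK ?num_real // lerXn2r // nnegrE.
have d2 : D' ^+ 2 <= h ^+ 2 * rho ^+ 2.
  by rewrite -exprMn -real_normK ?num_real // lerXn2r // nnegrE // mulr_ge0.
have vt : `|v / (2 * tau)| <= 3 / 2 * h * rho ^+ 2.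
  rewrite normrM normfV (gtr0_norm (_ : 0 < 2 * tau)) ?mulr_gt0 //.
  rewrite ler_pdivrMr ?mulr_gt0 //; apply: (le_trans vb).
  have : beta ^+ 2 <= rho ^+ 2 * tau.
    apply: (@le_trans _ _ (rho ^+ 2 * e ^+ 2)); last by rewrite ler_wpM2l ?exprn_ge0.
    by rewrite -exprMn /rho divfK // gt_eqF.
  move=> hb; rewrite (_ : _ * (2 * tau) = 3 * h * (rho ^+ 2 * tau)); last by field.
  by rewrite ler_wpM2l // mulr_ge0.
have H2 : 1 <= h ^+ 2 by rewrite exprn_ege1.
have hh2 : h <= h ^+ 2 by rewrite expr2 ler_peMr.
set B := h ^+ 2 * rho ^+ 3.
have r3 : 0 <= rho ^+ 3 by rewrite exprn_ge0.
have B1 : rho ^+ 3 <= B by rewrite /B ler_peMl.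
have B2 : h * rho ^+ 3 <= B by rewrite /B ler_wpM2r.
have t1 : `|T1| <= 10 * B.
  apply: (le_trans A1); rewrite ler_wpM2l //; apply: le_trans B1.
  by rewrite lerXn2r // nnegrE.
have t2 : `|x' * T2| <= 10 * B.
  rewrite normrM; apply: (@le_trans _ _ (rho * (10 * (h ^+ 2 * rho ^+ 2)))).
    by apply: ler_pM => //; apply: (le_trans A2); rewrite ler_wpM2l.
  by rewrite /B (_ : rho * _ = 10 * (h ^+ 2 * rho ^+ 3)); [|ring].
have t3 : `|x' * D' * T3| <= 10 * B.
  rewrite 2!normrM; apply: (@le_trans _ _ (rho * (h * rho) * (10 * (h * rho)))).
    apply: ler_pM; rewrite ?mulr_ge0 //; first by apply: ler_pM.
    by apply: (le_trans A3); rewrite ler_wpM2l.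
  by rewrite /B (_ : rho * _ * _ = 10 * (h ^+ 2 * rho ^+ 3)); [|ring].
have T4b : `|T4| <= 10 * (h * rho) by apply: (le_trans A4); rewrite ler_wpM2l.
have t4 : `|x' ^+ 2 / 2 * T4| <= 5 * B.
  rewrite normrM (ger0_norm (_ : 0 <= x' ^+ 2 / 2)) ?divr_ge0 ?sqr_ge0 //.
  apply: (@le_trans _ _ (rho ^+ 2 / 2 * (10 * (h * rho)))).
    by apply: ler_pM => //; rewrite ?divr_ge0 ?sqr_ge0 // ler_pM2r.
  have -> : rho ^+ 2 / 2 * (10 * (h * rho)) = 5 * (h * rho ^+ 3) by field.
  by rewrite ler_wpM2l.
have t5 : `|T5| <= 81 * B.
  apply: (le_trans A5); apply: (@le_trans _ _ (9 / (e ^+ 2) ^+ 2 * (3 * h * beta ^+ 2) ^+ 2)).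
    apply: ler_wpM2l; first by rewrite divr_ge0 // exprn_ge0 // exprn_ge0 // ltW.
    by rewrite -real_normK ?num_real // lerXn2r ?nnegrE // !mulr_ge0 ?exprn_ge0.
  have -> : 9 / (e ^+ 2) ^+ 2 * (3 * h * beta ^+ 2) ^+ 2 = 81 * (h ^+ 2 * rho ^+ 4).
    rewrite /rho; field; exact: lt0r_neq0.
  rewrite ler_wpM2l // /B ler_wpM2l ?exprn_ge0 //.
  by rewrite exprS ler_piMl.
have t6 : `|v / (2 * tau) * T4| <= 15 * B.
  rewrite normrM; apply: (@le_trans _ _ (3 / 2 * h * rho ^+ 2 * (10 * (h * rho)))).
    by apply: ler_pM.
  have -> : 3 / 2 * h * rho ^+ 2 * (10 * (h * rho)) = 15 * B by rewrite /B; field.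
  exact: lexx.
rewrite -(mulrA 131) -/B.
rewrite (_ : _ - _ = T1 - x' * T2 - x' * D' * T3 - x' ^+ 2 / 2 * T4 - T5 + v / (2 * tau) * T4);
  last first.
  rewrite /T1 /T2 /T3 /T4 /T5 /x' /D' tE; field; exact: lt0r_neq0.
move: t1 t2 t3 t4 t5 t6; rewrite !ler_norml.
clear A1 A2 A3 A4 A5 T4b.
move: T1 (x' * T2) (x' * D' * T3) (x' ^+ 2 / 2 * T4) T5 (v / (2 * tau) * T4) => *; lra.
Qed.

(** The hypotheses only constrain the means of [x k] against functions of the past
    sums; nothing is assumed on nonlinear functions of several future terms, which
    is why the replacement goes from the past to the future. *)
Section one_sided_lindeberg.
Context {d} {T : measurableType d} {R : realType} (P : probability T R).
Variables (x : nat -> T -> R) (beta eta1 eta2 : R) (l gap : nat).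

Definition psum p t : R := \sum_(1 <= i < p.+1) x i t.
Local Notation S := psum.

Definition test_fun (L : R) (phi : R -> R) :=
  [/\ 0 <= L, continuous phi, (exists M, forall s, `|phi s| <= M) &
      forall s s', `|phi s - phi s'| <= L * `|s - s'|].

Hypothesis mx : forall k, measurable_fun [set: T] (x k).
Hypothesis xb : forall k t, `|x k t| <= beta.
Hypothesis l_gt0 : (0 < l)%N.
Hypotheses (eta1_ge0 : 0 <= eta1) (eta2_ge0 : 0 <= eta2).
Hypothesis linear_mixing : forall phi L p k, test_fun L phi -> (p + l <= k)%N ->
  `|mean P (fun t => phi (S p t) * x k t)| <= eta1 * L.
Hypothesis quadratic_mixing : forall phi L p i k, test_fun L phi ->
  (p + gap <= i)%N -> (i <= k)%N -> (k < i + l)%N ->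
  decorr P (phi \o S p) (fun t => x k t * x i t) (eta2 * L).
Hypothesis orthogonal : forall i k, (i + l <= k)%N ->
  mean P (fun t => x k t * x i t) = 0.

Lemma beta_ge0 : 0 <= beta.
Proof. exact: le_trans (normr_ge0 _) (xb 0 point). Qed.

Lemma bmeas_x k : bmeas (x k).
Proof. by split; [exact: mx | exists beta; exact: xb]. Qed.

Lemma bmeas_S p : bmeas (S p).
Proof. by apply: bmeas_sum => i _; exact: bmeas_x. Qed.

Lemma S0 t : S 0 t = 0.
Proof. by rewrite /S big_geq. Qed.

Lemma SS p t : S p.+1 t = S p t + x p.+1 t.
Proof. by rewrite /S big_nat_recr. Qed.

Lemma S_split p k t : (p <= k)%N -> S k t = S p t + \sum_(p.+1 <= i < k.+1) x i t.
Proof. by move=> pk; rewrite /S -big_cat_nat. Qed.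

Lemma sum_x_bound p k t : (p <= k)%N ->
  `|\sum_(p.+1 <= i < k.+1) x i t| <= (k - p)%:R * beta.
Proof.
move=> pk; apply: le_trans (ler_norm_sum _ _ _) _.
apply: (@le_trans _ _ (\sum_(p.+1 <= i < k.+1) beta)); first exact: ler_sum.
by rewrite sumr_const_nat subSS mulr_natl.
Qed.

Lemma mean_xS k p : mean P (fun t => x k t * S p t) =
  \sum_(1 <= i < p.+1) mean P (fun t => x k t * x i t).
Proof.
rewrite -mean_sum; last by move=> i _; apply: bmeasM; exact: bmeas_x.
by congr mean; apply/funext => t; rewrite mulr_sumr.
Qed.

Lemma mean_xS_far k p : (p + l <= k)%N -> mean P (fun t => x k t * S p t) = 0.
Proof.
move=> pk; rewrite mean_xS big_nat_cond big1 // => i /andP[/andP[i1 ip] _].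
by apply: orthogonal; lia.
Qed.

Lemma mean_xS_near k p : (p < k)%N ->
  mean P (fun t => x k t * S p t) =
  \sum_((k - l).+1 <= i < p.+1) mean P (fun t => x k t * x i t).
Proof.
move=> pk; rewrite mean_xS.
have [pl|pl] := leqP p (k - l).
  rewrite [RHS]big_geq // big_nat_cond big1 // => i /andP[/andP[i1 ip] _].
  by apply: orthogonal; lia.
rewrite (@big_cat_nat _ _ _ (k - l).+1) //=; last by rewrite ltnS ltnW.
rewrite big_nat_cond big1 ?add0r // => i /andP[/andP[i1 ip] _].
by apply: orthogonal; lia.
Qed.

Lemma mean_xx_le k i : `|mean P (fun t => x k t * x i t)| <= beta ^+ 2.
Proof.
apply: normr_mean_le; first exact: measurable_funM.
by move=> t; rewrite normrM expr2; apply: ler_pM.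
Qed.

Lemma mean_xS_le k p : (p < k)%N -> `|mean P (fun t => x k t * S p t)| <= l%:R * beta ^+ 2.
Proof.
move=> pk; rewrite mean_xS_near //; apply: le_trans (ler_norm_sum _ _ _) _.
apply: (@le_trans _ _ (\sum_((k - l).+1 <= i < p.+1) beta ^+ 2)).
  by apply: ler_sum => i _; exact: mean_xx_le.
rewrite sumr_const_nat -[leLHS]mulr_natl ler_wpM2r ?sqr_ge0 // ler_nat; lia.
Qed.

Definition var k : R := mean P (fun t => S k t ^+ 2).

Lemma bmeas_sqr (f : T -> R) : bmeas f -> bmeas (fun t => f t ^+ 2).
Proof. by move=> bf; under eq_fun do rewrite expr2; exact: bmeasM. Qed.

Lemma varS k : var k.+1 - var k =
  2 * mean P (fun t => x k.+1 t * S k t) + mean P (fun t => x k.+1 t ^+ 2).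
Proof.
have b1 := bmeas_sqr (bmeas_S k); have b2 := bmeas_sqr (bmeas_x k.+1).
have b3 := bmeasM (bmeas_x k.+1) (bmeas_S k).
rewrite /var -(meanZ P 2 b3) -meanD //; last exact: bmeasZ.
rewrite -(meanB P (bmeas_sqr (bmeas_S _)) b1); congr mean.
by apply/funext => t; rewrite SS; ring.
Qed.

Lemma varS_le k : `|var k.+1 - var k| <= 3 * l%:R * beta ^+ 2.
Proof.
rewrite varS; apply: le_trans (ler_normD _ _) _.
rewrite normrM (@ger0_norm _ 2) //.
have h1 := mean_xS_le (ltnSn k).
have h2 : `|mean P (fun t => x k.+1 t ^+ 2)| <= beta ^+ 2.
  by under eq_fun do rewrite expr2; exact: mean_xx_le.
have h3 : beta ^+ 2 <= l%:R * beta ^+ 2 by rewrite ler_peMl ?sqr_ge0 // ler1n.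
lra.
Qed.

Lemma var0 : var 0 = 0.
Proof.
rewrite /var; under eq_fun do rewrite S0 expr0n /=.
exact: mean_cst.
Qed.

(** Only the [l] terms following [k] are correlated with the past, so the
    variance cannot drop by more than a constant number of terms. *)
Lemma var_almost_mono k e : var k - 2 * l%:R ^+ 2 * beta ^+ 2 <= var (k + e).
Proof.
pose E t := \sum_(k.+1 <= i < (k + e).+1) x i t.
have bE : bmeas E by apply: bmeas_sum => i _; exact: bmeas_x.
have bSE : bmeas (fun t => S k t * E t) by apply: bmeasM => //; exact: bmeas_S.
have VE : var (k + e) = var k + (2 * mean P (fun t => S k t * E t) + mean P (fun t => E t ^+ 2)).
  have b1 := bmeas_sqr (bmeas_S k); have b2 := bmeas_sqr bE.
  rewrite /var -meanZ // -meanD //; last exact: bmeasZ.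
  rewrite -meanD //; last by apply: bmeasD => //; exact: bmeasZ.
  congr mean; apply/funext => t; rewrite (S_split t (leq_addr e k)) -/(E t); ring.
have E0 : 0 <= mean P (fun t => E t ^+ 2).
  rewrite -(mean_cst P 0); apply: le_mean; [exact: bmeas_cst|exact: bmeas_sqr|].
  by move=> t; exact: sqr_ge0.
suff : `|mean P (fun t => S k t * E t)| <= l%:R * (l%:R * beta ^+ 2).
  rewrite ler_norml VE => /andP[+ _]; lra.
apply: (@le_trans _ _ ((minn e l)%:R * (l%:R * beta ^+ 2))); last first.
  by apply: ler_wpM2r; [rewrite mulr_ge0 ?sqr_ge0 | rewrite ler_nat geq_minr].
rewrite /E; elim: e {E bE bSE VE E0} => [|e IH].
  rewrite addn0; under eq_fun do rewrite big_geq // mulr0.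
  by rewrite mean_cst normr0 min0n mul0r.
pose E t := \sum_(k.+1 <= i < (k + e).+1) x i t.
have bE : bmeas E by apply: bmeas_sum => i _; exact: bmeas_x.
have -> : (fun t => S k t * \sum_(k.+1 <= i < (k + e.+1).+1) x i t) =
    fun t => S k t * E t + x (k + e.+1) t * S k t.
  apply/funext => t; rewrite addnS big_nat_recr /=; last by lia.
  by rewrite /E; ring.
rewrite meanD; last 2 first.
- by apply: bmeasM => //; exact: bmeas_S.
- by apply: bmeasM; [exact: bmeas_x|exact: bmeas_S].
have [le|el] := leqP l e.+1.
  rewrite mean_xS_far ?addr0; last by rewrite leq_add2l.
  apply: le_trans IH _; apply: ler_wpM2r; first by rewrite mulr_ge0 ?sqr_ge0.
  rewrite ler_nat; lia.
apply: le_trans (ler_normD _ _) _.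
have em : minn e l = e by lia.
rewrite em in IH.
rewrite -natr1 mulrDl mul1r; apply: lerD => //.
by apply: mean_xS_le; lia.
Qed.

Section telescoping.
Variables (n : nat) (a e : R).
Hypothesis e_gt0 : 0 < e.
Hypothesis var_n : var n = 1.
Let h := (gap + l)%N.
Hypothesis h_small : h%:R * beta <= e.

(** The increments of [var] are the variances consumed by the successive terms; as
    [var n = 1], what is left at the end is the smoothing time [4 * e ^ 2]. *)
Definition time k : R := 4 * e ^+ 2 + 1 - var k.
Definition smooth k t : R := Phi ((a - S k t) / Num.sqrt (time k)).

Local Notation rho := (beta / e).

Let lh : l%:R <= h%:R :> R. Proof. by rewrite ler_nat leq_addl. Qed.
Let h1 : 1 <= h%:R :> R. Proof. by rewrite ler1n addn_gt0 l_gt0 orbT. Qed.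
Let h0 : 0 <= h%:R :> R. Proof. exact: ler0n. Qed.
Let b0 : 0 <= beta. Proof. exact: beta_ge0. Qed.
Let be : beta <= e. Proof. by apply: le_trans h_small; rewrite ler_peMl. Qed.

Lemma time_ge k : (k <= n)%N -> e ^+ 2 <= time k.
Proof.
move=> kn; have := var_almost_mono k (n - k); rewrite subnKC // var_n /time.
have : l%:R ^+ 2 * beta ^+ 2 <= e ^+ 2.
  rewrite -exprMn lerXn2r ?nnegrE ?mulr_ge0 ?(ltW e_gt0) //.
  by apply: le_trans h_small; rewrite ler_wpM2r.
have : 0 <= e ^+ 2 by rewrite sqr_ge0.
lra.
Qed.

Lemma time_gt0 k : (k <= n)%N -> 0 < time k.
Proof. by move=> kn; apply: lt_le_trans (time_ge kn); rewrite exprn_gt0. Qed.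

Lemma sqrt_time_ge k : (k <= n)%N -> e <= Num.sqrt (time k).
Proof.
move=> kn; rewrite -[e]gtr0_norm // -sqrtr_sqr ler_wsqrtr //; exact: time_ge.
Qed.

Lemma test_fun_rescaled (f : R -> R) (B s : R) : 0 < s -> continuous f ->
  (forall z w, `|f (z + w) - f z| <= B * `|w|) -> (exists M, forall z, `|f z| <= M) ->
  test_fun (B / s) (fun y => f ((a - y) / s)).
Proof.
move=> s0 cf lf [M fM]; split.
- have := le_trans (normr_ge0 _) (lf 0 1); rewrite normr1 mulr1 => B0.
  by rewrite divr_ge0 // ltW.
- move=> y; apply: (@continuous_comp _ _ _ (fun y => (a - y) / s) f); last exact: cf.
  by apply: cvgM; [apply: cvgB; [exact: cvg_cst|exact: cvg_id]|exact: cvg_cst].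
- by exists M.
move=> y y'; rewrite -(subrKC ((a - y') / s) ((a - y) / s)).
apply: le_trans (lf _ _) _.
rewrite -mulrBl (_ : a - y - (a - y') = y' - y); last by ring.
rewrite normrM normfV (gtr0_norm s0) distrC mulrCA; lra.
Qed.

Lemma bmeas_smooth k : bmeas (smooth k).
Proof.
apply: (@bmeas_comp _ _ _ Phi _ 1 continuous_Phi).
  by move=> z; rewrite ger0_norm ?Phi_ge0 ?Phi_le1.
apply: measurable_funM => //; apply: measurable_funB => //; exact: (bmeas_S k).1.
Qed.

Definition step_error : R :=
  131 * h%:R ^+ 2 * rho ^+ 3 + 9 * eta1 / e ^+ 2 + 10 * h%:R * eta2 / e ^+ 3.

(** The linear term is negligible against the past up to [p = k.+1 - l]. A product
    [X * x i] with [i] after [p] decorrelates only from the past up to [p'], which is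
    [gap] steps earlier; its mean is then absorbed by the time increment. *)
Lemma smooth_step k : (k < n)%N -> (h <= k.+1)%N ->
  `|mean P (smooth k.+1) - mean P (smooth k)| <= step_error.
Proof.
move=> kn hk.
pose p := (k.+1 - l)%N; pose p' := (k.+1 - h)%N.
have [pk p'p] : (p <= k /\ p' <= p)%N by rewrite /p /p' /h; move: l_gt0; clear; lia.
have [d1 d2 d3] : [/\ k - p <= h, p - p' <= h & k - p' <= h]%N.
  by rewrite /p /p' /h; clear; split; lia.
have [pl p'gap] : (p + l <= k.+1 /\ p' + gap <= p)%N.
  by rewrite /p /p'; move: hk; rewrite /h; clear; lia.
pose s := Num.sqrt (time k.+1).
have es : e <= s := sqrt_time_ge kn.
have s0 : 0 < s := lt_le_trans e_gt0 es.
have t0 : 0 < time k.+1 := time_gt0 kn.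
have tE : time k.+1 = s ^+ 2 by rewrite /s sqr_sqrtr // ltW.
pose v := var k.+1 - var k.
pose D t := \sum_(p.+1 <= i < k.+1) x i t.
pose D2 t := \sum_(p'.+1 <= i < p.+1) x i t.
pose X := x k.+1.
pose f1 y := gd ((a - y) / s); pose f2 y := gd1 ((a - y) / s).
pose Q t := X t * D t + X t ^+ 2 / 2.
have tf1 : test_fun (9 / s) f1.
  apply: (@test_fun_rescaled gd) => //; [exact: continuous_gd|exact: gd_lip|].
  by exists 1 => z; rewrite ger0_norm ?gd_ge0 ?gd_le1.
have tf2 : test_fun (10 / s) f2.
  apply: (@test_fun_rescaled gd1) => //; [exact: continuous_gd1|exact: gd1_lip|].
  by exists 9; exact: gd1_bound.
have btf L phi q : test_fun L phi -> bmeas (phi \o S q).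
  by move=> [_ cphi [M phiM] _]; apply: (bmeas_comp cphi phiM); exact: (bmeas_S q).1.
have bD : bmeas D by apply: bmeas_sum => i _; exact: bmeas_x.
have bX : bmeas X := bmeas_x k.+1.
have bQ : bmeas Q.
  by apply: bmeasD; [exact: bmeasM|apply: bmeasM; [exact: bmeas_sqr|exact: bmeas_cst]].
have pointwise t : `|smooth k.+1 t - smooth k t + X t / s * f1 (S p t)
    - (Q t - v / 2) / time k.+1 * f2 (S p' t)| <= 131 * h%:R ^+ 2 * rho ^+ 3.
  have := @lindeberg_pointwise R a (S p' t) (D2 t) (D t) (X t) v e beta h%:R
    (time k.+1) (time k) e_gt0 b0 be h1 (time_ge kn) (time_ge (ltnW kn)).
  rewrite -(S_split t p'p) -(S_split t pk) -SS; apply.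
  - by rewrite /time /v; ring.
  - exact: xb.
  - apply: le_trans (sum_x_bound t pk) _; by rewrite ler_wpM2r // ler_nat.
  - apply: le_trans (sum_x_bound t p'p) _; by rewrite ler_wpM2r // ler_nat.
  - rewrite addrC /D /D2 -big_cat_nat //.
    apply: le_trans (sum_x_bound t (leq_trans p'p pk)) _.
    by rewrite ler_wpM2r // ler_nat.
  by apply: (le_trans (varS_le k)); rewrite ler_wpM2r ?sqr_ge0 // ler_wpM2l.
have vE : v = 2 * mean P Q.
  rewrite /v varS.
  have -> : mean P (fun t => x k.+1 t * S k t) = mean P (fun t => X t * D t).
    have -> : (fun t => x k.+1 t * S k t) = fun t => X t * S p t + X t * D t.
      by apply/funext => t; rewrite (S_split t pk) mulrDr.
    rewrite meanD ?mean_xS_far ?add0r //; last exact: bmeasM.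
    by apply: bmeasM => //; exact: bmeas_S.
  have -> : mean P Q = mean P (fun t => X t * D t) + 2^-1 * mean P (fun t => X t ^+ 2).
    rewrite -meanZ; last exact: bmeas_sqr.
    rewrite -meanD; [|exact: bmeasM|by apply: bmeasZ; exact: bmeas_sqr].
    by congr mean; apply/funext => t; rewrite /Q mulrC; congr (_ + _); rewrite mulrC.
  by rewrite /X; field.
have linear : `|mean P (fun t => X t / s * f1 (S p t))| <= 9 * eta1 / e ^+ 2.
  have -> : (fun t => X t / s * f1 (S p t)) = fun t => s^-1 * (f1 (S p t) * X t).
    by apply/funext => t; ring.
  rewrite meanZ; last by apply: bmeasM => //; exact: (btf _ _ _ tf1).
  rewrite normrM normfV (gtr0_norm s0).
  have H : `|mean P (fun t => f1 (S p t) * X t)| <= eta1 * (9 / s).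
    exact: linear_mixing.
  apply: (@le_trans _ _ (s^-1 * (eta1 * (9 / s)))).
    by rewrite ler_wpM2l // invr_ge0 ltW.
  rewrite (_ : s^-1 * (eta1 * (9 / s)) = 9 * eta1 / s ^+ 2); last by field; exact: lt0r_neq0.
  rewrite ler_wpM2l ?mulr_ge0 // lef_pV2 ?posrE ?exprn_gt0 //.
  by rewrite lerXn2r // nnegrE ltW.
have quadratic : `|mean P (fun t => (Q t - v / 2) / time k.+1 * f2 (S p' t))|
    <= 10 * h%:R * eta2 / e ^+ 3.
  have bF := btf _ _ p' tf2.
  pose c i : R := if i == k.+1 then 2^-1 else 1.
  have QE : Q = fun t => \sum_(p.+1 <= i < k.+2 | (p.+1 <= i < k.+2)%N && true) c i * (X t * x i t).
    apply/funext => t; rewrite -big_nat_cond big_nat_recr //=.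
    rewrite /c eqxx /Q /D mulr_sumr /X; congr (_ + _); last by field.
    apply: eq_big_nat => i /andP[_ ik].
    by rewrite (ltn_eqF ik) mul1r.
  have dec : decorr P (f2 \o S p') Q
      ((\sum_(p.+1 <= i < k.+2 | (p.+1 <= i < k.+2)%N && true) `|c i|) * (eta2 * (10 / s))).
    rewrite QE; apply: decorr_sum => // i /andP[/andP[ip ik] _].
      by apply: bmeasM => //; exact: bmeas_x.
    apply: quadratic_mixing => //; first exact: leq_trans p'gap (ltnW ip).
    by move: ip; rewrite /p; clear; lia.
  have cs : \sum_(p.+1 <= i < k.+2 | (p.+1 <= i < k.+2)%N && true) `|c i| <= h%:R.
    rewrite -big_nat_cond; apply: (@le_trans _ _ (\sum_(p.+1 <= i < k.+2) 1)).
      apply: ler_sum => i _; rewrite /c; case: ifP => _; rewrite ?normr1 //.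
      by rewrite ger0_norm ?invr_ge0 // invf_le1 // ler1n.
    by rewrite sumr_const_nat ler_nat subSS /p /h; clear; lia.
  have -> : (fun t => (Q t - v / 2) / time k.+1 * f2 (S p' t)) = fun t =>
      (time k.+1)^-1 * (f2 (S p' t) * Q t - mean P Q * f2 (S p' t)).
    by apply/funext => t; rewrite vE; field; exact: lt0r_neq0.
  rewrite meanZ; last first.
    by apply: bmeasB; [exact: bmeasM|exact: bmeasZ].
  rewrite meanB; [|exact: bmeasM|exact: bmeasZ].
  rewrite meanZ // (mulrC (mean P Q)) normrM normfV (gtr0_norm t0).
  apply: (@le_trans _ _ ((time k.+1)^-1 * (h%:R * (eta2 * (10 / s))))).
    rewrite ler_wpM2l ?invr_ge0 ?(ltW t0) //; apply: le_trans dec _.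
    by rewrite ler_wpM2r // mulr_ge0 // divr_ge0 // ltW.
  have -> : (time k.+1)^-1 * (h%:R * (eta2 * (10 / s))) = 10 * h%:R * eta2 / s ^+ 3.
    by rewrite tE; field; exact: lt0r_neq0.
  rewrite ler_wpM2l ?mulr_ge0 // lef_pV2 ?posrE ?exprn_gt0 //.
  by rewrite lerXn2r // nnegrE ltW.
have bA : bmeas (fun t => X t / s * f1 (S p t)).
  apply: bmeasM; last exact: (btf _ _ _ tf1).
  by apply: bmeasM => //; exact: bmeas_cst.
have bB : bmeas (fun t => (Q t - v / 2) / time k.+1 * f2 (S p' t)).
  apply: bmeasM; last exact: (btf _ _ _ tf2).
  by apply: bmeasM; [apply: bmeasB => //|]; exact: bmeas_cst.
have bs1 := bmeas_smooth k.+1; have bs0 := bmeas_smooth k.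
have b2 := bmeasD (bmeasB bs1 bs0) bA.
have main := normr_mean_le P (bmeasB b2 bB).1 pointwise.
rewrite (meanB _ b2 bB) (meanD _ (bmeasB bs1 bs0) bA) (meanB _ bs1 bs0) in main.
have combine (u A B E1 E2 E3 : R) : `|u + A - B| <= E1 -> `|A| <= E2 -> `|B| <= E3 ->
    `|u| <= E1 + E2 + E3 by rewrite !ler_norml; lra.
exact: combine main linear quadratic.
Qed.

Lemma smooth_step_crude k : (k < n)%N ->
  `|mean P (smooth k.+1) - mean P (smooth k)| <= 16 * h%:R * rho.
Proof.
move=> kn; rewrite -(meanB P (bmeas_smooth _) (bmeas_smooth _)).
apply: normr_mean_le; first exact: (bmeasB (bmeas_smooth _) (bmeas_smooth _)).1.
move=> t; have es := sqrt_time_ge kn.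
have s0 : 0 < Num.sqrt (time k.+1) by exact: lt_le_trans es.
have r0 : 0 <= rho by rewrite divr_ge0 // ltW.
have r1 : rho <= 1 by rewrite ler_pdivrMr // mul1r.
pose z := (a - S k t) / Num.sqrt (time k.+1).
have A1 : `|smooth k.+1 t - Phi z| <= rho.
  rewrite /smooth SS (_ : _ / _ = z + - (x k.+1 t / Num.sqrt (time k.+1))); last first.
    by rewrite /z; field; exact: lt0r_neq0.
  apply: le_trans (Phi_lip _ _) _; rewrite normrN normrM normfV (gtr0_norm s0).
  apply: ler_pM => //; rewrite ?invr_ge0 ?(ltW s0) //.
  by rewrite lef_pV2 ?posrE.
have A2 : `|Phi z - smooth k t| <= 15 * h%:R * rho.
  rewrite /z /smooth; apply: le_trans
    (Phi_time_lip _ (exprn_gt0 2 e_gt0) (time_ge (ltnW kn)) (time_ge kn)) _.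
  rewrite (_ : time k.+1 - time k = - (var k.+1 - var k)); last by rewrite /time; ring.
  rewrite normrN; apply: (@le_trans _ _ (5 / e ^+ 2 * (3 * h%:R * beta ^+ 2))).
    apply: ler_wpM2l; first by rewrite divr_ge0 // exprn_ge0 // ltW.
    by apply: (le_trans (varS_le k)); rewrite ler_wpM2r ?sqr_ge0 // ler_wpM2l.
  have -> : 5 / e ^+ 2 * (3 * h%:R * beta ^+ 2) = 15 * h%:R * (rho * rho).
    by field; exact: lt0r_neq0.
  by rewrite ler_wpM2l ?mulr_ge0 // ler_piMl.
rewrite -(subrKA (Phi z)); apply: le_trans (ler_normD _ _) _.
rewrite (_ : 16 * h%:R * rho = h%:R * rho + 15 * h%:R * rho); last by ring.
by apply: lerD => //; apply: le_trans A1 _; rewrite ler_peMl.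
Qed.

(** The step estimate fails for the first [h] indices, which have no remote past;
    a cruder bound is enough for so few of them. *)
Lemma clt_smoothed :
  `|mean P (fun t => Phi ((a - S n t) / (2 * e))) - Phi a| <=
  n%:R * step_error + 16 * h%:R ^+ 2 * rho + 20 * e ^+ 2.
Proof.
have r0 : 0 <= rho by rewrite divr_ge0 // ltW.
have se0 : 0 <= step_error.
  by rewrite !addr_ge0 // ?mulr_ge0 ?invr_ge0 ?exprn_ge0 ?(ltW e_gt0).
have hN : (0 < h)%N by rewrite /h addn_gt0 l_gt0 orbT.
have addl_le (u w A B C : R) : u <= A -> w <= B + C -> u + w <= B + A + C by lra.
have addr_le (u w A B C : R) : u <= A -> w <= B + C -> u + w <= B + (C + A) by lra.
have conclude (m p q A B C D E : R) : `|m - p| <= A + B -> `|p - q| <= 5 * (4 * E) ->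
  A <= C -> B <= D -> `|m - q| <= C + D + 20 * E by rewrite !ler_norml; lra.
have sum k : (k <= n)%N -> `|mean P (smooth k) - mean P (smooth 0)| <=
    (k.+1 - h)%:R * step_error + (minn k h.-1)%:R * (16 * h%:R * rho).
  elim: k => [|k IH] kn.
    rewrite subrr normr0 min0n mul0r addr0 mulr_ge0 //.
  rewrite -(subrKA (mean P (smooth k))); apply: le_trans (ler_normD _ _) _.
  have {IH} := IH (ltnW kn); have [hk|kh] := leqP h k.+1.
    have := smooth_step kn hk.
    have -> : (k.+2 - h = (k.+1 - h).+1)%N by rewrite subSn.
    have -> : minn k.+1 h.-1 = minn k h.-1 by move: hN hk; clear; lia.
    rewrite -[(k.+1 - h).+1%:R]natr1 (mulrDl _ 1 step_error) mul1r => hs IH.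
    exact: addl_le hs IH.
  have := smooth_step_crude kn.
  have -> : (k.+2 - h = k.+1 - h)%N by move: kh; clear; lia.
  have -> : minn k.+1 h.-1 = (minn k h.-1).+1 by move: hN kh; clear; lia.
  rewrite -[(minn k h.-1).+1%:R]natr1 (mulrDl _ 1 (16 * _ * _)) mul1r => hs IH.
  exact: addr_le hs IH.
have := sum n (leqnn n).
have s2e : Num.sqrt (4 * e ^+ 2) = 2 * e.
  by rewrite (_ : 4 * e ^+ 2 = (2 * e) ^+ 2) ?sqrtr_sqr ?gtr0_norm ?mulr_gt0 //; ring.
rewrite {1}/smooth /time var_n addrK s2e.
have -> : mean P (smooth 0) = Phi (a / Num.sqrt (1 + 4 * e ^+ 2)).
  rewrite /smooth /time var0 subr0 (addrC _ 1) -[RHS](mean_cst P); congr mean.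
  by apply/funext => t; rewrite S0 subr0.
have h3 : `|Phi (a / Num.sqrt (1 + 4 * e ^+ 2)) - Phi (a / Num.sqrt 1)| <=
    5 / 1 * `|1 + 4 * e ^+ 2 - 1|.
  by apply: Phi_time_lip => //; rewrite lerDl mulr_ge0 // sqr_ge0.
have e4 : 0 <= 4 * e ^+ 2 by rewrite mulr_ge0 // sqr_ge0.
rewrite sqrtr1 !divr1 addrAC subrr add0r (ger0_norm e4) in h3.
have c1 : (n.+1 - h)%:R * step_error <= n%:R * step_error.
  by rewrite ler_wpM2r // ler_nat; move: hN; clear; lia.
have c2 : (minn n h.-1)%:R * (16 * h%:R * rho) <= 16 * h%:R ^+ 2 * rho.
  have -> : 16 * h%:R ^+ 2 * rho = h%:R * (16 * h%:R * rho) by ring.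
  apply: ler_wpM2r; first by apply: mulr_ge0 => //; exact: mulr_ge0.
  rewrite ler_nat; move: hN; clear; lia.
by move=> h4; exact: conclude h4 h3 c1 c2.
Qed.

End telescoping.
End one_sided_lindeberg.

(** * From smoothed to actual distribution functions *)

Section smoothing.
Context {d} {T : measurableType d} {R : realType} (P : probability T R).

Lemma mean_indic (A : set T) : measurable A -> mean P (\1_A) = fine (P A).
Proof. by move=> mA; rewrite /mean /Rintegral integral_indic // setIT. Qed.

Lemma bmeas_indic (A : set T) : measurable A -> bmeas (\1_A : T -> R).
Proof.
move=> mA; split; first exact: measurable_indic.
by exists 1 => t; rewrite indicE; case: (t \in A); rewrite ?normr1 ?normr0.
Qed.

(** Shifting the threshold by [b] turns the smoothed indicator into an upper or a
    lower bound for the indicator, up to the Gaussian tail beyond [b / s]; this is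
    useful for [s] much smaller than [b]. *)
Lemma cdf_smoothing (X : {RV P >-> R}) (s b eta : R) : 0 < s -> 0 < b ->
  (forall a, `|mean P (fun t => Phi ((a - X t) / s)) - Phi a| <= eta) ->
  forall a, `|fine (cdf X a) - Phi a| <= eta + b + 9 * (s / b).
Proof.
move=> s0 b0 smooth a.
pose A := X @^-1` `]-oo, a]%classic.
have mA : measurable A by rewrite -[A]setTI; exact: measurable_funP.
have -> : fine (cdf X a) = mean P (\1_A) by rewrite mean_indic.
have bI := bmeas_indic mA.
have bPhi y : bmeas (fun t => Phi ((y - X t) / s)).
  apply: (@bmeas_comp _ _ _ Phi (fun t => (y - X t) / s) 1 continuous_Phi).
    by move=> z; rewrite ger0_norm ?Phi_ge0 ?Phi_le1.
  by apply: measurable_funM => //; apply: measurable_funB.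
have bs0 : 0 < b / s by rewrite divr_gt0.
have tail : 9 / (b / s) = 9 * (s / b) by rewrite invf_div.
have up := Phi_upper_tail bs0; have lo := Phi_lower_tail bs0.
rewrite tail in up lo.
have PL y : `|Phi (a + y) - Phi a| <= `|y| := Phi_lip a y.
rewrite ler_norml; apply/andP; split.
  have h : mean P (fun t => Phi ((a - b - X t) / s)) <=
      mean P (fun t => \1_A t + Phi (- (b / s))).
    apply: le_mean => // [|t]; first by apply: bmeasD => //; exact: bmeas_cst.
    rewrite indicE; have [tA|tA] := boolP (t \in A).
      by apply: (le_trans (Phi_le1 _)); rewrite lerDl Phi_ge0.
    rewrite add0r; apply: le_Phi; rewrite -mulNr ler_pM2r ?invr_gt0 //.
    suff : a < X t by lra.
    by rewrite ltNge; apply: contra tA => tA; rewrite inE /A /= in_itv.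
  rewrite meanD ?mean_cst in h; [|exact: bI|exact: bmeas_cst].
  have := smooth (a - b); have := PL (- b); rewrite normrN (gtr0_norm b0) !ler_norml.
  move: h lo; clear; lra.
have h : mean P (\1_A) <= mean P (fun t => Phi ((a + b - X t) / s) + (1 - Phi (b / s))).
  apply: le_mean => // [|t]; first by apply: bmeasD => //; exact: bmeas_cst.
  rewrite indicE; have [tA|tA] := boolP (t \in A).
    rewrite addrCA lerDl subr_ge0; apply: le_Phi; rewrite ler_pM2r ?invr_gt0 //.
    by move: tA; rewrite inE /A /= in_itv /=; lra.
  by rewrite addr_ge0 ?Phi_ge0 // subr_ge0 Phi_le1.
rewrite meanD ?mean_cst in h; [|exact: bPhi|exact: bmeas_cst].
have := smooth (a + b); have := PL b; rewrite (gtr0_norm b0) !ler_norml.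
move: h up; clear; lra.
Qed.

Lemma cdf_normal (Y : {RV P >-> R}) (a : R) :
  (forall B : set R, measurable B -> distribution P Y B = normal_prob (0 : R) 1 B) ->
  fine (cdf Y a) = Phi a.
Proof. by move=> H; rewrite /cdf H. Qed.

Lemma fine_cdf_itv (X : {RV P >-> R}) (a : R) : 0 <= fine (cdf X a) <= 1.
Proof.
rewrite fine_ge0 ?cdf_ge0 //= -lee_fin fineK ?cdf_le1 //.
by rewrite /cdf fin_num_measure.
Qed.

End smoothing.

Lemma kolmogorov_dist_le d1 d2 (T1 : measurableType d1) (T2 : measurableType d2)
    (R : realType) (P : probability T1 R) (Q : probability T2 R)
    (X : {RV P >-> R}) (Y : {RV Q >-> R}) (B : R) :
  (forall a, `|fine (cdf X a) - fine (cdf Y a)| <= B) -> kolmogorov_dist P Q X Y <= B.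
Proof.
move=> H; apply: ge_sup; last by move=> _ [a _ <-]; exact: H.
by exists `|fine (cdf X 0) - fine (cdf Y 0)|; exists 0.
Qed.

Lemma L2normE (R : realType) (f : torus R -> R) : bmeas f ->
  L2norm f = (Num.sqrt (mean (@lebesgue_torus R) (fun t => f t ^+ 2)))%:E.
Proof.
move=> bf; have b2 : bmeas (fun t => f t ^+ 2).
  by under eq_fun do rewrite expr2; exact: bmeasM.
rewrite /L2norm unlock.
under eq_integral do rewrite /= powR_mulrn // real_normK ?num_real //.
have fin := integrable_fin_num measurableT (bmeas_integrable (@lebesgue_torus R) b2).
rewrite -[X in poweR X _]fineK // poweR_EFin powR12_sqrt //.
by apply: fine_ge0; apply: integral_ge0 => t _; rewrite lee_fin sqr_ge0.
Qed.

(** * The rate of convergence *)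

Section lacunary_clt.
Context {R : realType}.
Variables (A : nat -> 'M[int]_2) (posA : forall k, (1 <= k)%N -> posSL2 (A k)).
Variables (l : seq (R * (int * int) * R)) (r b : nat).
Hypothesis l0 : {in l, forall z, z.1.2 != 0}.
Hypothesis lr : {in l, forall z, nrm1 z.1.2 < 2 ^+ r}.
Hypothesis hb : forall k i j, (1 <= k)%N -> 2 * A k i j <= 2 ^+ b.

Local Notation mu := (@lebesgue_torus R).
Local Notation G := (amplitude l).

(** [window q] steps make two terms orthogonal and gain a factor [2 ^ (6 * q)] in the
    linear mixing estimate; [lag q] adds the delay needed for products of terms
    within a window. *)
Definition window (q : nat) : nat := (6 * q + r.*2.+1)%N.
Definition lag (q : nat) : nat := (b * window q + r.+2 + window q)%N.

Lemma wave_sum_clt (n q : nat) (s e a : R) : 0 < s -> 0 < e ->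
  mean mu (fun t => (\sum_(1 <= k < n.+1) s^-1 * wsum l A k t) ^+ 2) = 1 ->
  (lag q)%:R * (G / s) <= e ->
  `|mean mu (fun t => Phi ((a - \sum_(1 <= k < n.+1) s^-1 * wsum l A k t) / (2 * e))) - Phi a|
  <= n%:R * (131 * (lag q)%:R ^+ 2 * (G / s / e) ^+ 3
             + 9 * (16 * 2 ^+ r * (G / s) ^+ 2 / 2 ^+ (6 * q)) / e ^+ 2
             + 10 * (lag q)%:R * (16 * 2 ^+ r * (G / s) ^+ 3) / e ^+ 3)
     + 16 * (lag q)%:R ^+ 2 * (G / s / e) + 20 * e ^+ 2.
Proof.
move=> s0 e0 varn small.
have G0 : 0 <= G := amplitude_ge0 l.
have si : 0 <= s^-1 by rewrite invr_ge0 ltW.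
have b0 : 0 <= G / s by rewrite mulr_ge0.
have c0 : 0 <= 16 * 2 ^+ r :> R by rewrite mulr_ge0 // exprn_ge0.
pose x k t := s^-1 * wsum l A k t.
have psumE p t : psum x p t = s^-1 * \sum_(1 <= k < p.+1) wsum l A k t.
  by rewrite /psum mulr_sumr.
have bphi L phi p : test_fun L phi -> bmeas (phi \o psum x p : torus R -> R).
  move=> [_ cphi [M phiM] _]; apply: (bmeas_comp cphi phiM).
  apply: measurable_fun_sumr => k; exact: (bmeasZ s^-1 (bmeas_wsum l A k)).1.
have lphi L phi p : test_fun L phi ->
    xlip (L / s * (16 * 2 ^+ r * G * (rowsum A p)%:~R)) (phi \o psum x p : torus R -> R).
  move=> [L0 _ _ Lphi].
  have := xlip_comp L0 Lphi (xlipZ s^-1 (xlip_sum_wsum posA lr p)).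
  rewrite (ger0_norm si) !mulrA.
  rewrite (_ : (fun t => s^-1 * _) = psum x p) //.
  by apply/funext => t; rewrite psumE.
have rs p : 0 < (rowsum A p)%:~R :> R := rowsumR_gt0 posA p.
apply: (@clt_smoothed _ _ _ mu x (G / s) _ _ (window q) (b * window q + r.+2)) => //.
- by move=> k; exact: (bmeasZ s^-1 (bmeas_wsum l A k)).1.
- move=> k t; rewrite normrM (ger0_norm si) mulrC ler_wpM2r //; exact: wsum_bound.
- by rewrite /window addnS.
- by rewrite divr_ge0 ?exprn_ge0 // mulr_ge0 // exprn_ge0.
- by rewrite mulr_ge0 // exprn_ge0.
- move=> phi L p k tf pk; have [L0 _ _ _] := tf.
  pose ex := (k - p - r.+1)%N.
  have kE : k = (p + (ex + r.+1))%N by rewrite /ex; move: pk; rewrite /window; clear; lia.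
  have exq : (6 * q <= ex)%N by rewrite /ex; move: pk; rewrite /window; clear; lia.
  have -> : (fun t => phi (psum x p t) * x k t) =
      fun t => s^-1 * ((phi \o psum x p) t * wsum l A k t).
    by apply/funext => t; rewrite /x /=; ring.
  rewrite meanZ; last by apply: bmeasM; [exact: bphi tf|exact: bmeas_wsum].
  rewrite normrM (ger0_norm si) kE.
  apply: (@le_trans _ _ (s^-1 * (G * (L / s * (16 * 2 ^+ r * G * (rowsum A p)%:~R)
      / ((rowsum A p)%:~R * 2 ^+ ex))))).
    by rewrite ler_wpM2l //; apply: mean_mul_wsum_le => //; [exact: bphi tf|exact: lphi].
  have -> : s^-1 * (G * (L / s * (16 * 2 ^+ r * G * (rowsum A p)%:~R)
      / ((rowsum A p)%:~R * 2 ^+ ex))) = 16 * 2 ^+ r * (G / s) ^+ 2 * L / 2 ^+ ex.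
    have E0 : (2 : R) ^+ ex != 0 by rewrite lt0r_neq0 // exprn_gt0.
    move: E0; move: (2 ^+ ex) (rowsum A p)%:~R (rs p) => E' rp rp0 E0.
    by field; rewrite E0 ?lt0r_neq0.
  rewrite [leLHS]mulrAC ler_wpM2r //.
  apply: ler_wpM2l; first by rewrite mulr_ge0 // exprn_ge0.
  by rewrite lef_pV2 ?posrE ?exprn_gt0 // ler_eXn2l // ltr1n.
- move=> phi L p i k tf pi_ ik kl; have [L0 _ _ _] := tf.
  have kE : k = (i + (k - i))%N by rewrite subnKC.
  have -> : (fun t => x k t * x i t) = fun t => s^-1 ^+ 2 * (wsum l A k t * wsum l A i t).
    by apply/funext => t; rewrite /x; ring.
  have bW : bmeas (fun t => wsum l A k t * wsum l A i t) by apply: bmeasM; exact: bmeas_wsum.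
  have bF := bphi _ _ p tf.
  have dec : decorr mu (phi \o psum x p) (fun t => wsum l A k t * wsum l A i t)
      (G * (G * (L / s * (16 * 2 ^+ r * G * (rowsum A p)%:~R) / (rowsum A p)%:~R))).
    have := @decorr_wsum_mul _ A posA l r lr b _ _ p (k - i) i hb bF (lphi _ _ p tf).
    rewrite subnKC //; apply; apply: leq_trans pi_; rewrite leq_add2l.
    have : (b * (k - i) <= b * window q)%N.
      by rewrite leq_mul2l ltnW ?orbT // ltn_subLR // addnC.
    clear; lia.
  rewrite /decorr (_ : (fun t => _) =
    fun t => s^-1 ^+ 2 * ((phi \o psum x p) t * (wsum l A k t * wsum l A i t))); last first.
    by apply/funext => t; ring.
  rewrite !meanZ //; last exact: bmeasM.
  rewrite mulrCA -mulrBr normrM ger0_norm ?exprn_ge0 //.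
  apply: (@le_trans _ _ (s^-1 ^+ 2 * (G * (G * (L / s * (16 * 2 ^+ r * G * (rowsum A p)%:~R)
      / (rowsum A p)%:~R))))); first by rewrite ler_wpM2l ?exprn_ge0.
  rewrite le_eqVlt; apply/orP; left; apply/eqP; field.
  by rewrite (lt0r_neq0 (rs p)) (lt0r_neq0 s0).
- move=> i k ik; pose ex := (k - i - r.+1)%N.
  have kE : k = (i + (ex + r.+1))%N by rewrite /ex; move: ik; rewrite /window; clear; lia.
  have exr : (r <= ex)%N by rewrite /ex; move: ik; rewrite /window; clear; lia.
  have -> : (fun t => x k t * x i t) = fun t => s^-1 ^+ 2 * (wsum l A k t * wsum l A i t).
    by apply/funext => t; rewrite /x; ring.
  rewrite meanZ; last by apply: bmeasM; exact: bmeas_wsum.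
  by rewrite kE mean_wsum_mul0 ?mulr0.
Qed.

End lacunary_clt.

(** Multiplying out the powers of [q], each of the five terms is at most a constant
    times [1 / q]; the first one, for instance, is of order
    [n * beta ^ 2 * h ^ 2 * beta * q ^ 6], that is [q ^ 8 / q ^ 16]. *)
Lemma rate_arith (R : realType) (q n : nat) (beta h D c H e : R) :
  (0 < q)%N -> 0 <= beta -> 0 <= D -> 0 <= h -> 0 <= c -> n%:R * beta ^+ 2 <= c ^+ 2 ->
  beta <= c / q%:R ^+ 16 -> h <= H * q%:R ->
  e = (2 * q%:R ^+ 2)^-1 ->
  n%:R * (131 * h ^+ 2 * (beta / e) ^+ 3 + 9 * (D * beta ^+ 2 / 2 ^+ (6 * q)) / e ^+ 2
             + 10 * h * (D * beta ^+ 3) / e ^+ 3)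
     + 16 * h ^+ 2 * (beta / e) + 20 * e ^+ 2
  <= (1048 * H ^+ 2 * c ^+ 3 + 36 * D * c ^+ 2 + 80 * H * D * c ^+ 3
      + 32 * H ^+ 2 * c + 5) / q%:R.
Proof.
move=> q0 b0 D0 h0 c0 nb bc hH eE.
have Q1 : 1 <= q%:R :> R by rewrite ler1n.
have Q0 : 0 < q%:R :> R by exact: lt_le_trans Q1.
have E0 : 0 < (2 : R) ^+ (6 * q) by rewrite exprn_gt0.
have pE : q%:R ^+ 4 / 2 ^+ (6 * q) <= q%:R^-1 :> R.
  rewrite ler_pdivrMr // mulrC ler_pdivlMr // -exprSr.
  apply: (@le_trans _ _ (q%:R ^+ 6)); first by rewrite ler_weXn2l.
  rewrite mulnC exprM lerXn2r ?nnegrE ?exprn_ge0 // -natrX ler_nat.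
  exact: ltnW (ltn_expl _ _).
have pw j : (j < 16)%N -> q%:R ^+ j / q%:R ^+ 16 <= q%:R^-1 :> R.
  move=> j16; rewrite ler_pdivrMr ?exprn_gt0 // mulrC ler_pdivlMr // -exprSr.
  by rewrite ler_weXn2l.
have pw8 := pw 8 isT; have pw7 := pw 7 isT; have pw4 := pw 4 isT; clear pw.
have pi4 : (q%:R ^+ 4)^-1 <= q%:R^-1 :> R.
  by rewrite lef_pV2 ?posrE ?exprn_gt0 // -[leLHS]expr1 ler_weXn2l.
have N0 : 0 <= n%:R :> R := ler0n _ _.
move: q%:R n%:R (2 ^+ (6 * q)) N0 Q1 Q0 E0 pE pw8 pw7 pw4 pi4 nb bc hH eE => Q N E.
move=> N0 Q1 Q0 E0 pE pw8 pw7 pw4 pi4 nb bc hH eE {q0 q n}.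
have [Qn En] := (lt0r_neq0 Q0, lt0r_neq0 E0).
have H0 : 0 <= H by rewrite -(pmulr_lge0 _ Q0); exact: le_trans hH.
have nb0 : 0 <= N * beta ^+ 2 by rewrite mulr_ge0 // sqr_ge0.
have c20 : 0 <= c ^+ 2 := sqr_ge0 c.
have h20 : 0 <= h ^+ 2 := sqr_ge0 h.
have hH2 : h ^+ 2 <= (H * Q) ^+ 2 by rewrite lerXn2r // nnegrE // (le_trans h0).
have Qge j : 0 <= Q ^+ j by rewrite exprn_ge0 // ltW.
have bQ j : beta * Q ^+ j <= c / Q ^+ 16 * Q ^+ j by rewrite ler_wpM2r.
have bQ0 j : 0 <= beta * Q ^+ j by rewrite mulr_ge0.
have u1 : N * beta ^+ 2 * (h ^+ 2 * (beta * Q ^+ 6)) <= H ^+ 2 * c ^+ 3 / Q.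
  apply: (@le_trans _ _ (c ^+ 2 * ((H * Q) ^+ 2 * (c / Q ^+ 16 * Q ^+ 6)))).
    by apply: ler_pM => //; [exact: mulr_ge0|exact: ler_pM].
  have -> : c ^+ 2 * ((H * Q) ^+ 2 * (c / Q ^+ 16 * Q ^+ 6)) =
      H ^+ 2 * c ^+ 3 * (Q ^+ 8 / Q ^+ 16) by field.
  by rewrite ler_wpM2l // mulr_ge0 ?exprn_ge0.
have u2 : D * (N * beta ^+ 2 * (Q ^+ 4 / E)) <= D * (c ^+ 2 / Q).
  by rewrite ler_wpM2l // ler_pM // divr_ge0 // ltW.
have u3 : D * (N * beta ^+ 2 * (h * (beta * Q ^+ 6))) <= D * (H * c ^+ 3 / Q).
  rewrite ler_wpM2l //; apply: (@le_trans _ _ (c ^+ 2 * (H * Q * (c / Q ^+ 16 * Q ^+ 6)))).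
    by apply: ler_pM => //; [exact: mulr_ge0|exact: ler_pM].
  have -> : c ^+ 2 * (H * Q * (c / Q ^+ 16 * Q ^+ 6)) =
      H * c ^+ 3 * (Q ^+ 7 / Q ^+ 16) by field.
  by rewrite ler_wpM2l // mulr_ge0 ?exprn_ge0.
have u4 : h ^+ 2 * (beta * Q ^+ 2) <= H ^+ 2 * c / Q.
  apply: (@le_trans _ _ ((H * Q) ^+ 2 * (c / Q ^+ 16 * Q ^+ 2))); first by rewrite ler_pM.
  have -> : (H * Q) ^+ 2 * (c / Q ^+ 16 * Q ^+ 2) = H ^+ 2 * c * (Q ^+ 4 / Q ^+ 16) by field.
  by rewrite ler_wpM2l // mulr_ge0 ?exprn_ge0.
have -> : N * (131 * h ^+ 2 * (beta / e) ^+ 3 + 9 * (D * beta ^+ 2 / E) / e ^+ 2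
             + 10 * h * (D * beta ^+ 3) / e ^+ 3)
     + 16 * h ^+ 2 * (beta / e) + 20 * e ^+ 2 =
    1048 * (N * beta ^+ 2 * (h ^+ 2 * (beta * Q ^+ 6)))
    + 36 * (D * (N * beta ^+ 2 * (Q ^+ 4 / E)))
    + 80 * (D * (N * beta ^+ 2 * (h * (beta * Q ^+ 6))))
    + 32 * (h ^+ 2 * (beta * Q ^+ 2)) + 5 * (Q ^+ 4)^-1.
  by rewrite eE; field; rewrite Qn En.
have -> : (1048 * H ^+ 2 * c ^+ 3 + 36 * D * c ^+ 2 + 80 * H * D * c ^+ 3
      + 32 * H ^+ 2 * c + 5) / Q =
    1048 * (H ^+ 2 * c ^+ 3 / Q) + 36 * (D * (c ^+ 2 / Q))
    + 80 * (D * (H * c ^+ 3 / Q)) + 32 * (H ^+ 2 * c / Q) + 5 * Q^-1 by field.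
exact: (lerD (lerD (lerD (lerD (ler_wpM2l (ler0n R 1048) u1)
  (ler_wpM2l (ler0n R 36) u2)) (ler_wpM2l (ler0n R 80) u3))
  (ler_wpM2l (ler0n R 32) u4)) (ler_wpM2l (ler0n R 5) pi4)).
Qed.

Lemma exists_exp2_bound (T : eqType) (s : seq T) (f : T -> int) :
  exists r : nat, {in s, forall x, f x < 2 ^+ r}.
Proof.
elim: s => [|x s [r IH]]; first by exists 0%N.
exists (maxn r `|f x|%N) => y; rewrite inE => /predU1P[->|/IH ys].
  apply: (@lt_le_trans _ _ (2 ^+ `|f x|%N)); last by rewrite ler_weXn2l // leq_maxr.
  apply: (@le_lt_trans _ _ (`|f x|%N%:Z)); first by lia.
  by rewrite -(natrX int 2) natz ltz_nat ltn_expl.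
by apply: lt_le_trans ys _; rewrite ler_weXn2l // leq_maxl.
Qed.

(** The integer part of the root of order 32 of [n] is the natural parameter: all
    the scales of the proof are of the order of powers of it. *)
Lemma exists_root32 (n : nat) : exists q : nat, (q ^ 32 <= n < q.+1 ^ 32)%N.
Proof.
have exq : exists q, (q ^ 32 <= n)%N by exists 0%N.
have ub q : (q ^ 32 <= n)%N -> (q <= n)%N.
  by apply: leq_trans; case: q => // q; rewrite -[X in (X <= _)%N]expn1 leq_pexp2l.
case: (ex_maxnP exq ub) => q qn qmax; exists q; rewrite qn ltnNge.
by apply/negP => /qmax; rewrite ltnn.
Qed.

Lemma powR_root32 (R : realType) (n q : nat) : (0 < n)%N -> (n < q.+1 ^ 32)%N ->
  q.+1%:R^-1 <= n%:R `^ (- (1 / 32)) :> R.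
Proof.
move=> n0 nq; rewrite powRN lef_pV2 ?posrE ?powR_gt0 ?ltr0n //.
have -> : q.+1%:R = (q.+1%:R ^+ 32) `^ (1 / 32) :> R.
  by rewrite -powR_mulrn // -powRrM (_ : 32%:R * (1 / 32) = 1) ?powRr1 //; field.
by apply: ge0_ler_powR; rewrite ?nnegrE ?exprn_ge0 // -natrX ler_nat ltnW.
Qed.

Lemma lag_le (b r q : nat) : (0 < q)%N ->
  (lag r b q <= (b * (7 + 2 * r) + r + 2 + (7 + 2 * r)) * q)%N.
Proof.
move=> q0; rewrite /lag /window -mul2n.
have w : (6 * q + (2 * r).+1 <= (7 + 2 * r) * q)%N by case: q q0 => // q _; nia.
have := leq_mul (leqnn b) w; nia.
Qed.

Theorem theorem3p14 (R : realType)
  (calA : set 'M[int]_2) (fin_calA : finite_set calA)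
  (SL2_calA : forall M : 'M[int]_2, calA M -> \det M = 1)
  (pos_calA : forall M : 'M[int]_2, calA M -> forall i j : 'I_2, 0 < M i j)
  (A : nat -> 'M[int]_2) (A_in : forall k : nat, (1 <= k)%N -> calA (A k))
  (g : trigpoly R) (g_zero_mean : (\int[@lebesgue_torus R]_t (g t)%:E = 0)%E)
  (C1 : R) (C1_gt0 : 0 < C1) (n0 : nat) (n0_ge1 : (1 <= n0)%N)
  (S_large : forall n : nat, (n0 <= n)%N ->
    ((C1 * n%:R `^ (1 / 2))%:E <= L2norm (ergodic_sum A g n))%E)
  (d : measure_display) (Omega : measurableType d) (P : probability Omega R)
  (Y1 : {RV P >-> R})
  (Y1_law : forall B : set R, measurable B ->
    distribution P Y1 B = normal_prob (0 : R) 1 B) :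
  exists C : R, forall n : nat, (n0 <= n)%N ->
    kolmogorov_dist (@lebesgue_torus R) P (normalized_sum A g n) Y1
      <= C * n%:R `^ (- (1 / 32)).
Proof.
set mu := @lebesgue_torus R.
have posA k : (1 <= k)%N -> posSL2 (A k).
  by move=> /A_in Ak; split; [exact: SL2_calA|exact: pos_calA].
have [l [l0 gE]] := trigpoly_wsum0 g_zero_mean.
have [r lr] := exists_exp2_bound l (fun z => nrm1 z.1.2).
have [b hb] : exists b : nat, forall k i j, (1 <= k)%N -> 2 * A k i j <= 2 ^+ b.
  have /finite_seqP[ms msE] := fin_calA.
  have [b bb] := exists_exp2_bound [seq (M, ij) | M <- ms, ij <- enum {: 'I_2 * 'I_2}]
    (fun z => 2 * z.1 z.2.1 z.2.2).
  exists b => k i j k1; apply: ltW.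
  apply: (bb (A k, (i, j))); apply/allpairsP; exists (A k, (i, j)).
  by split => //; [have := A_in k k1; rewrite msE | rewrite mem_enum].
pose G : R := amplitude l; have G0 : 0 <= G := amplitude_ge0 l.
pose c := G / C1; have c0 : 0 <= c by rewrite divr_ge0 // ltW.
pose H : R := (b * (7 + 2 * r) + r + 2 + (7 + 2 * r))%:R.
have H0 : 0 <= H := ler0n _ _.
pose D : R := 16 * 2 ^+ r; have D0 : 0 <= D by rewrite mulr_ge0 // exprn_ge0.
have [K K0 KE] : exists2 K : R, 0 <= K &
    K = 1048 * H ^+ 2 * c ^+ 3 + 36 * D * c ^+ 2 + 80 * H * D * c ^+ 3
      + 32 * H ^+ 2 * c + 5.
  eexists; last reflexivity.
  have nat_coef (m : nat) (x y : R) : 0 <= x -> 0 <= y -> 0 <= m%:R * x * y.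
    by move=> x0 y0; rewrite !mulr_ge0.
  have [[c2 c3] H2] := (exprn_ge0 2 c0, exprn_ge0 3 c0, exprn_ge0 2 H0).
  apply: addr_ge0; last exact: (ler0n R 5).
  apply: addr_ge0; last exact: (nat_coef 32).
  apply: addr_ge0; last exact: (mulr_ge0 (nat_coef 80 _ _ H0 D0) c3).
  by apply: addr_ge0; [exact: (nat_coef 1048) | exact: (nat_coef 36)].
exists (2 * (K + 10) + (2 * H * c + 1)) => n nn0.
have n1 : (0 < n)%N := leq_trans n0_ge1 nn0.
have [q /andP[qn nq]] := exists_root32 n.
have rate := powR_root32 R n1 nq.
have Hc0 : 0 <= 2 * H * c := mulr_ge0 (mulr_ge0 (ler0n R 2) H0) c0.
have K1 : 0 <= K + 10 := addr_ge0 K0 (ler0n R 10).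
have K10 : 0 <= 2 * (K + 10) := mulr_ge0 (ler0n R 2) K1.
apply: (@le_trans _ _ ((2 * (K + 10) + (2 * H * c + 1)) / q.+1%:R)); last first.
  by apply: ler_wpM2l => //; exact: (addr_ge0 K10 (addr_ge0 Hc0 ler01)).
apply: kolmogorov_dist_le => a.
have q1gt0 : 0 < q.+1%:R :> R by rewrite ltr0n.
have [qsmall|qlarge] := leP q.+1%:R (2 * H * c + 1).
  (* The constant contains [2 * H * c + 1], so that here the bound is at least one. *)
  apply: (@le_trans _ _ 1).
    have unit_dist (x y : R) : 0 <= x <= 1 -> 0 <= y <= 1 -> `|x - y| <= 1.
      by rewrite ler_norml; lra.
    by apply: unit_dist; exact: fine_cdf_itv.
  by rewrite ler_pdivlMr // mul1r (le_trans qsmall) // lerDr.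
have qHc : 2 * H * c <= q%:R by rewrite ltW // -(ltrD2r 1) natr1.
have q0 : (0 < q)%N.
  rewrite lt0n; apply: contraTneq qlarge => ->.
  by rewrite -leNgt lerDr.
have Q0 : 0 < q%:R :> R by rewrite ltr0n.
have Q1 : 1 <= q%:R :> R by rewrite ler1n.
pose S := ergodic_sum A g n.
have SE : S = fun t => \sum_(1 <= k < n.+1) wsum l A k t.
  by apply/funext => t; rewrite /S /ergodic_sum; apply: eq_bigr => k _; exact: gE.
have bS : bmeas S by rewrite SE; apply: bmeas_sum => k _; exact: bmeas_wsum.
pose s := fine (L2norm S).
have sE : s = Num.sqrt (mean mu (fun t => S t ^+ 2)) by rewrite /s L2normE.
have s_large : C1 * Num.sqrt n%:R <= s.
  have := S_large n nn0; rewrite -/S L2normE // lee_fin -sE.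
  by rewrite (_ : 1 / 2 = 2^-1) ?powR12_sqrt // mul1r.
have sn0 : 0 < Num.sqrt n%:R :> R by rewrite sqrtr_gt0 ltr0n.
have s0 : 0 < s by apply: lt_le_trans s_large; rewrite mulr_gt0.
have sn16 : q%:R ^+ 16 <= Num.sqrt n%:R :> R.
  rewrite -(@ler_pXn2r _ 2) ?nnegrE ?exprn_ge0 ?(ltW Q0) ?(ltW sn0) // sqr_sqrtr //.
  by rewrite -exprM -natrX ler_nat.
pose beta := G / s.
have beta0 : 0 <= beta by rewrite divr_ge0 // ltW.
have nbeta : n%:R * beta ^+ 2 <= c ^+ 2.
  have h : Num.sqrt n%:R * beta <= c.
    rewrite /beta /c mulrA ler_pdivrMr // [leLHS]mulrC -mulrA ler_wpM2l //.
    by rewrite ler_pdivlMl.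
  have -> : n%:R = Num.sqrt n%:R ^+ 2 :> R by rewrite sqr_sqrtr.
  by rewrite -exprMn lerXn2r // nnegrE mulr_ge0 // ltW.
have betaq : beta <= c / q%:R ^+ 16.
  rewrite /beta /c -mulrA -invfM ler_wpM2l // lef_pV2 ?posrE ?mulr_gt0 ?exprn_gt0 //.
  by apply: le_trans s_large; rewrite ler_wpM2l // ltW.
(* The smoothing width is [2 * e = q ^ -2] and the threshold is shifted by [1 / q],
   so that the Gaussian tail in cdf_smoothing is of order [1 / q] as well. *)
pose e : R := (2 * q%:R ^+ 2)^-1.
have e0 : 0 < e by rewrite invr_gt0 mulr_gt0 // exprn_gt0.
have lagH : (lag r b q)%:R <= H * q%:R by rewrite /H -natrM ler_nat lag_le.
have small : (lag r b q)%:R * (G / s) <= e.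
  apply: (@le_trans _ _ (H * q%:R * (c / q%:R ^+ 16))); first by apply: ler_pM.
  have -> : H * q%:R * (c / q%:R ^+ 16) = 2 * H * c * q%:R / (2 * q%:R ^+ 16).
    by field; exact: lt0r_neq0.
  rewrite /e ler_pdivrMr ?mulr_gt0 ?exprn_gt0 //.
  rewrite (_ : _^-1 * _ = q%:R ^+ 14); last by field; exact: lt0r_neq0.
  apply: (@le_trans _ _ (q%:R * q%:R)); first by rewrite ler_wpM2r // ltW.
  by rewrite -expr2 ler_weXn2l.
have varn : mean mu (fun t => (\sum_(1 <= k < n.+1) s^-1 * wsum l A k t) ^+ 2) = 1.
  have -> : (fun t => (\sum_(1 <= k < n.+1) s^-1 * wsum l A k t) ^+ 2) =
      fun t => s^-1 ^+ 2 * S t ^+ 2.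
    by apply/funext => t; rewrite SE -mulr_sumr exprMn.
  rewrite meanZ; last by under eq_fun do rewrite expr2; exact: bmeasM.
  have -> : mean mu (fun t => S t ^+ 2) = s ^+ 2.
    rewrite sE sqr_sqrtr // -(mean_cst mu 0); apply: le_mean; first exact: bmeas_cst.
      by under eq_fun do rewrite expr2; exact: bmeasM.
    by move=> t; exact: sqr_ge0.
  by rewrite -exprMn mulVf ?expr1n // lt0r_neq0.
have smoothed y : `|mean mu (fun t => Phi ((y - normalized_sum A g n t) / (2 * e))) - Phi y|
    <= K / q%:R.
  have -> : normalized_sum A g n =
      (fun t => \sum_(1 <= k < n.+1) s^-1 * wsum l A k t) :> (torus R -> R).
    by apply/funext => t; rewrite /normalized_sum -/S -/s SE mulrC mulr_sumr.
  apply: le_trans (wave_sum_clt posA l0 lr hb y s0 e0 varn small) _.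
  rewrite KE; exact: (@rate_arith R q n (G / s) _ D c H e).
have e20 : 0 < 2 * e by rewrite mulr_gt0.
have b0 : 0 < q%:R^-1 :> R by rewrite invr_gt0.
rewrite (cdf_normal a Y1_law); apply: le_trans (cdf_smoothing e20 b0 smoothed a) _.
have -> : K / q%:R + q%:R^-1 + 9 * (2 * e / q%:R^-1) = (K + 10) / q%:R.
  by rewrite /e; field; exact: lt0r_neq0.
rewrite ler_pdivlMr // mulrAC ler_pdivrMr //.
apply: (@le_trans _ _ ((K + 10) * (2 * q%:R))).
  by apply: ler_wpM2l => //; rewrite -[q.+1%:R]natr1 mulr_natl mulr2n lerD2l.
rewrite mulrA (mulrC _ 2) ler_wpM2r ?(ltW Q0) // lerDl; exact: (addr_ge0 Hc0 ler01).
Qed.
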